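(* Let $A$ be an Artin algebra. If $A$ is syzygy finite, then $$\mathrm{dell}(A)\le \mathrm{Dell}(A)\le \phi\dim(A)<\infty.$$
   Context: Modules are right modules; $\mathrm{mod}\,A$ is the category of finitely generated right $A$-modules and $\underline{\mathrm{mod}}\,A$ its stable category (modulo projectives). $\Omega(M)$ is the syzygy of $M$ (kernel of a projective cover), $\Omega^0(M)=M$, $\Omega^{n+1}(M)=\Omega(\Omega^n(M))$. For $M\in\mathrm{mod}\,A$, $\mathrm{dell}(M)=\inf\{n\ge 0:\Omega^n(M)$ is a direct summand of $\Omega^{n+1}(N)$ in $\underline{\mathrm{mod}}\,A$ for some $N\in\mathrm{mod}\,A\}$, with $\mathrm{dell}(M)=\infty$ if no such $n$ exists. $\mathrm{dell}(A)=\sup\{\mathrm{dell}(S): S \text{ a simple } A\text{-module}\}$ and $\mathrm{Dell}(A)=\sup\{\mathrm{dell}(M): M\in\mathrm{mod}\,A\}$ (two different invariants). $K_0(A)$ is the quotient of the free abelian group on symbols $[M]$, one for each isomorphism class of modules $M\in\mathrm{mod}\,A$, by the relations $[M]-[M']-[M'']$ whenever $M\cong M'\oplus M''$, and $[P]$ for each projective $P$. $\bar\Omega:K_0(A)\to K_0(A)$ is the endomorphism with $\bar\Omega([M])=[\Omega(M)]$. $K_i(A)=\bar\Omega^i(K_0(A))$. The algebra $A$ is syzygy finite if there is $n\ge 0$ such that $\bar\Omega^n(K_0(A))$ is a finitely generated group. For $M\in\mathrm{mod}\,A$, $\langle\mathrm{add}\,M\rangle\subset K_0(A)$ is the subgroup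 generated by the classes of indecomposable direct summands of $M$. The Igusa–Todorov function is $\phi(M)=\eta_{\bar\Omega}(\langle \mathrm{add}\,M\rangle)$, where for a finitely generated subgroup $G\subset K_0(A)$, $\eta_{\bar\Omega}(G)$ is the smallest $n\ge0$ such that $\bar\Omega:\bar\Omega^{m}(G)\to\bar\Omega^{m+1}(G)$ is an isomorphism for all $m\ge n$. $\phi\dim(A)=\sup\{\phi(M):M\in\mathrm{mod}\,A\}$. *)

(* Defs.v *)
From HB Require Import structures.
From Stdlib Require Import ClassicalEpsilon.
From mathcomp Require Import all_boot all_order all_algebra.
From mathcomp Require Import boolp classical_sets functions constructive_ereal.
From mathcomp Require Import freeg.
Set Implicit Arguments.
Unset Strict Implicit.
Unset Printing Implicit Defensive.
Import Order.TTheory GRing.Theory Num.Theory.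
Import ring_quotient.Quotient.Exports.
Local Open Scope classical_set_scope.
Local Open Scope ring_scope.
Local Open Scope quotient_scope.

Section Modules.
Variable R : nzRingType.
Implicit Types M N P : lmodType R.

Definition finitely_generated M : Prop :=
  exists (n : nat) (v : 'I_n -> M),
    forall x, exists c : 'I_n -> R, x = \sum_i c i *: v i.

Definition artinian M : Prop :=
  forall U : nat -> {pred M},
    (forall n, submod_closed (U n)) ->
    (forall n, {subset U n.+1 <= U n}) ->
    exists n, forall m, (n <= m)%N -> U m =i U n.

Definition isomorphic M N : Prop :=
  exists f : {linear M -> N}, bijective f.

Definition surjective M N (f : M -> N) : Prop := forall y, exists x, f x = y.

Definition direct_summand N M : Prop :=
  exists N' : lmodType R, isomorphic M (N * N')%type.

Definition zero_module M : Prop := forall x : M, x = 0.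

Definition simple_module M : Prop :=
  ~ zero_module M /\
  forall U : {pred M}, submod_closed U -> U =i pred1 0 \/ U =i predT.

Definition indecomposable M : Prop :=
  ~ zero_module M /\
  forall N N' : lmodType R,
    isomorphic M (N * N')%type -> zero_module N \/ zero_module N'.

Definition projective P : Prop :=
  forall (M N : lmodType R) (g : {linear M -> N}) (f : {linear P -> N}),
    surjective g -> exists h : {linear P -> M}, forall x, g (h x) = f x.

Definition superfluous P (K : set P) : Prop :=
  forall U : {pred P}, submod_closed U ->
    (forall x, exists2 u, u \in U & K (x - u)) -> U =i predT.

Definition projective_cover P M (p : {linear P -> M}) : Prop :=
  [/\ projective P, surjective p & superfluous [set x | p x = 0]].

End Modules.

Definition artin_algebra (k : comNzRingType) (A : algType k) : Prop :=
  artinian k^o /\ @finitely_generated k A.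

(* Right A-modules are left modules over the converse ring A^c. *)
Record fgmod (A : nzRingType) := FgMod {
  fgmod_sort :> lmodType A^c;
  fgmodP : finitely_generated fgmod_sort
}.

Section SubgroupGen.
Variable V : zmodType.

Definition subgroup_gen (S : set V) : set V :=
  [set x | forall H : {pred V},
     zmod_closed H -> (forall y, S y -> y \in H) -> x \in H].

Definition fg_subgroup (G : set V) : Prop :=
  exists s : seq V, G = subgroup_gen [set x | x \in s].

Lemma subgroup_gen_closed (S : set V) :
  zmod_closed (in_set (subgroup_gen S)).
Proof.
split=> [|x y]; first by rewrite inE /= => H [].
rewrite !inE /= => Sx Sy H cH sH; case: (cH) => _; apply.
  exact: Sx.
exact: Sy.
Qed.

End SubgroupGen.

Section K0.
Variable A : nzRingType.
Implicit Types M N : fgmod A.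

(* All pairs (n, U) with M isomorphic to A^n / U.  This set of pairs depends on
   M only up to isomorphism and determines its isomorphism class
   (presentations_iso), and it lives in the universe of A; so it serves
   as the isomorphism class of M. *)
Definition presentations (M : lmodType A^c) : set {n & set 'rV[A^c]_n} :=
  [set p | exists2 f : {linear 'rV[A^c]_(projT1 p) -> M},
     surjective f & projT2 p = [set v | f v = 0]].

Lemma presentations_iso M N :
  presentations M = presentations N <-> isomorphic M N.
Proof.
split=> [eMN|[h [h' hK h'K]]]; last first.
  have eq0 x : (h x = 0) <-> (x = 0).
    by split=> [e|->]; [rewrite -(hK x) e -[RHS]hK linear0|rewrite linear0].
  apply/seteqP; split=> -[n U] [f sf /= ->].
    exists (h \o f : {linear _ -> N}).
      by move=> y; have [x fx] := sf (h' y); exists x; rewrite /= fx h'K.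
    by apply/seteqP; split=> v /= /eq0.
  have h'L : linear h'.
    by move=> a u v; apply: (can_inj hK); rewrite linearP !h'K.
  pose g := HB.pack_for {linear N -> M} h'
    (GRing.isLinear.Build A^c N M *:%R h' h'L).
  have eq0' y : (g y = 0) <-> (y = 0).
    by split=> [e|->]; [rewrite -(h'K y) /= [h' y]e linear0|rewrite linear0].
  exists (g \o f : {linear _ -> M}).
    by move=> x; have [y fy] := sf (h x); exists y; rewrite /= fy hK.
  by apply/seteqP; split=> v /= /eq0'.
have [n [v vP]] := fgmodP M.
pose f (c : 'rV[A^c]_n) : M := \sum_i c 0 i *: v i.
have fL : linear f.
  move=> a c d; rewrite /f scaler_sumr -big_split; apply: eq_bigr => i _.
  by rewrite !mxE scalerDl scalerA.
have [f1 fs] : exists f1 : {linear 'rV[A^c]_n -> M}, surjective f1.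
  exists (HB.pack_for {linear 'rV[A^c]_n -> M} f
    (GRing.isLinear.Build A^c 'rV[A^c]_n M *:%R f fL)).
  move=> x; have [c ->] := vP x; exists (\row_i c i).
  by apply: eq_bigr => i _; rewrite mxE.
have : presentations M (existT _ n [set c | f1 c = 0]) by exists f1.
rewrite eMN => -[/= g gs /seteqP[kfg kgf]].
have fgE x y : f1 x = f1 y <-> g x = g y.
  split=> e; apply/eqP; rewrite -subr_eq0 -linearB; apply/eqP.
    by apply: kfg; rewrite /= linearB e subrr.
  by apply: kgf; rewrite /= linearB e subrr.
pose s x := projT1 (cid (fs x)); pose t y := projT1 (cid (gs y)).
have sK x : f1 (s x) = x := projT2 (cid (fs x)).
have tK y : g (t y) = y := projT2 (cid (gs y)).
have hL : linear (g \o s).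
  by move=> a x y; rewrite /= -linearP; apply/fgE; rewrite linearP !sK.
pose h := HB.pack_for {linear M -> N} (g \o s)
    (GRing.isLinear.Build A^c M N *:%R (g \o s) hL).
exists h; exists (f1 \o t) => x.
  by rewrite /= -[RHS]sK; apply/fgE; rewrite tK.
by rewrite /= -[RHS]tK; apply/fgE; rewrite sK.
Qed.

Definition iso_class : Type :=
  {S : set {n & set 'rV[A^c]_n} | exists M, S = presentations M}.

Definition iso_class_of M : {classic iso_class} :=
  exist _ (presentations M) (ex_intro _ M erefl).

Definition K0_relations : set {freeg {classic iso_class}} :=
  [set r | (exists M M' M'', isomorphic M (M' * M'')%type /\
              r = << iso_class_of M >> - << iso_class_of M' >>
                  - << iso_class_of M'' >>)
        \/ (exists2 P : fgmod A, projective P & r = << iso_class_of P >>)].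

Definition K0_null : {pred {freeg {classic iso_class}}} :=
  in_set (subgroup_gen K0_relations).

HB.instance Definition _ :=
  GRing.isZmodClosed.Build {freeg {classic iso_class}} K0_null
    (subgroup_gen_closed K0_relations).

Definition K0 : zmodType := {ideal_quot K0_null}.

Definition K0_class M : K0 := \pi_({ideal_quot K0_null}) << iso_class_of M >>.

Definition is_syzygy M K : Prop :=
  exists (P : fgmod A) (p : {linear P -> M}) (i : {linear K -> P}),
    [/\ projective_cover p, injective i & range i = [set x | p x = 0]].

(* The default M is never used over an Artin algebra, where projective
   covers exist and finitely generated modules are Noetherian. *)
Definition syzygy M : fgmod A := epsilon (inhabits M) (is_syzygy M).

(* The classes [M] generate K0, so at most one endomorphism maps every [M] to
   [syzygy M]; over an Artin algebra there is one, and the default idfun is not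
   used. *)
Definition K0_syzygy : {additive K0 -> K0} :=
  epsilon (inhabits (idfun : {additive K0 -> K0}))
    (fun f => forall M, f (K0_class M) = K0_class (syzygy M)).

Definition syzygy_finite : Prop :=
  exists n, fg_subgroup (iter n K0_syzygy @` setT).

Definition add_subgroup M : set K0 :=
  subgroup_gen [set c | exists N : fgmod A,
    [/\ indecomposable N, direct_summand N M & c = K0_class N]].

End K0.

(* Invariants with values in N U {oo} are taken in \bar int. *)
Definition nat_inf (S : set nat) : \bar int :=
  infimum +oo%E [set n%:Z%:E | n in S].

(* Every set of elements of N U {oo} has a supremum in \bar int; for the empty
   set, 0 is the supremum in N U {oo}. *)
Definition inv_sup (S : set (\bar int)) : \bar int := supremum 0%E S.

Section Invariants.
Variable A : nzRingType.
Implicit Types M N : fgmod A.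

(* Equality of morphisms in the stable category *)
Definition stably_equal (M N : lmodType A^c) (f g : M -> N) : Prop :=
  exists (P : fgmod A) (a : {linear M -> P}) (b : {linear P -> N}),
    projective P /\ forall x, f x - g x = b (a x).

Definition stably_isomorphic (M N : lmodType A^c) : Prop :=
  exists (f : {linear M -> N}) (g : {linear N -> M}),
    stably_equal (g \o f) idfun /\ stably_equal (f \o g) idfun.

Definition stable_summand (X Y : fgmod A) : Prop :=
  exists Z : fgmod A, stably_isomorphic Y (X * Z)%type.

Definition dell M : \bar int :=
  nat_inf [set n | exists N,
    stable_summand (iter n (@syzygy A) M) (iter n.+1 (@syzygy A) N)].

Definition dell_alg : \bar int :=
  inv_sup [set d | exists2 S : fgmod A, simple_module S & d = dell S].

Definition Dell : \bar int := inv_sup [set d | exists M, d = dell M].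

Definition eta (G : set (K0 A)) : \bar int :=
  nat_inf [set n | forall m, (n <= m)%N ->
    set_bij (iter m (K0_syzygy A) @` G) (iter m.+1 (K0_syzygy A) @` G)
      (K0_syzygy A)].

Definition phi M : \bar int := eta (add_subgroup M).

Definition phidim : \bar int := inv_sup [set d | exists M, d = phi M].

End Invariants.

Arguments dell_alg : clear implicits.
Arguments Dell : clear implicits.
Arguments phidim : clear implicits.

(* Main.v *)
From HB Require Import structures.
Require Import Defs.
From mathcomp Require Import all_boot all_order all_algebra.
From mathcomp Require Import boolp classical_sets functions constructive_ereal.
From mathcomp Require Import freeg.
Set Implicit Arguments.
Unset Strict Implicit.
Unset Printing Implicit Defensive.
Import Order.TTheory GRing.Theory Num.Theory.
Local Open Scope classical_set_scope.
Local Open Scope ring_scope.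
Import ring_quotient.Quotient.Exports.
Local Open Scope quotient_scope.

(** The easy inequality dell(A) <= Dell(A) compares suprema of two sets, the
first contained in the second.  For the rest, write L for the endomorphism of
K_0(A) induced by the syzygy.

Finiteness of phidim(A).  Say that L is injective at level m if its
restriction to L^m(K_0(A)) is injective.  If L^n(K_0(A)) is finitely generated,
it is a Noetherian group, so the kernels of the powers of L on it stabilise;
hence there is d such that L is injective at every level m >= d
([iter_inj_eventually]), and then every phi(M) is at most d ([phi_le]).

The bound Dell(A) <= phidim(A).  Put d = phidim(A).  Every element of K_0(A)
is a difference [U] - [V], so it lies in the subgroup of U + V, and phi(U + V)
<= d shows that L is injective at level d ([phi_le_injective]).  For a module
M let w = L^d [M].  As L^n(K_0(A)) is a finitely generated group, the sequence
L^n w, L^(n+1) w, ... satisfies a monic linear relation with integer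
coefficients; since L is injective at level d, the powers of L can be
cancelled in it until the constant coefficient t is nonzero, and then t w lies
in L^(d+1)(K_0(A)) ([iter_multiple]).  With t > 0 this reads
  t [Omega^d M] + [Omega^(d+1) Y] = [Omega^(d+1) X]
for some X and Y.  An equality of classes in K_0(A) is an isomorphism up to
projective summands ([K0_class_eq]), so Omega^d M is a stable direct summand of
Omega^(d+1) X, that is, dell(M) <= d ([dell_le]).

The structure theory behind this uses the Artin algebra only through the fact
that finitely generated modules satisfy both chain conditions
([artin_finite_length]).  It gives projective covers
([projective_cover_exists]), the Fitting dichotomy for endomorphisms of
indecomposable modules ([fitting]), and from it the cancellation of direct
summands ([cancellableT]), which is what makes equality in K_0(A) mean stable
isomorphism.  Schanuel's lemma makes the syzygy an endomorphism of K_0(A)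
([K0_syzygyE]). *)

(** * Linear maps *)

Section LinearMaps.
Variable R : nzRingType.
Implicit Types M N : lmodType R.

Definition mklin M N (f : M -> N) (fL : linear f) : {linear M -> N} :=
  HB.pack_for {linear M -> N} f (GRing.isLinear.Build R M N *:%R f fL).

Lemma inl_linear M N : linear (fun x : M => (x, 0) : (M * N)%type).
Proof. by move=> a u v; congr pair; rewrite /= scaler0 addr0. Qed.

Lemma inr_linear M N : linear (fun y : N => (0, y) : (M * N)%type).
Proof. by move=> a u v; congr pair; rewrite /= scaler0 addr0. Qed.

Definition in1 M N : {linear M -> (M * N)%type} := mklin (@inl_linear M N).
Definition in2 M N : {linear N -> (M * N)%type} := mklin (@inr_linear M N).

Lemma iter_linear M (f : {linear M -> M}) n : linear (iter n f).
Proof. by elim: n => [|n IH] // a u v; rewrite iterS IH linearP. Qed.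

End LinearMaps.

(** * Submodules, spans and chain conditions *)

Section Submodules.
Variables (R : nzRingType) (M : lmodType R).
Implicit Types (U V : set M) (s : seq M).

Definition submodule U : Prop :=
  U 0 /\ forall a x y, U x -> U y -> U (a *: x + y).

Lemma submodule_closed U : submodule U -> submod_closed (in_set U).
Proof.
move=> [U0 UP]; split; first exact/mem_set.
by move=> a x y /set_mem Ux /set_mem Uy; apply/mem_set/UP.
Qed.

Lemma submoduleD U x y : submodule U -> U x -> U y -> U (x + y).
Proof. by case=> _ UP Ux Uy; rewrite -[x]scale1r; apply: UP. Qed.

Lemma submoduleZ U a x : submodule U -> U x -> U (a *: x).
Proof. by case=> U0 UP Ux; rewrite -[_ *: _]addr0; apply: UP. Qed.

Lemma submoduleN U x : submodule U -> U x -> U (- x).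
Proof. by move=> sU Ux; rewrite -scaleN1r; apply: submoduleZ. Qed.

Lemma submoduleB U x y : submodule U -> U x -> U y -> U (x - y).
Proof. by move=> sU Ux Uy; apply: submoduleD => //; apply: submoduleN. Qed.

Lemma submodule_sum U (I : Type) (r : seq I) (P : pred I) (F : I -> M) :
  submodule U -> (forall i, P i -> U (F i)) -> U (\sum_(i <- r | P i) F i).
Proof.
move=> sU UF; elim/big_rec: _ => [|i x Pi Ux]; first by case: sU.
by apply: submoduleD => //; apply: UF.
Qed.

Lemma submoduleI U V : submodule U -> submodule V -> submodule (U `&` V).
Proof.
move=> [U0 UP] [V0 VP]; split=> // a x y [Ux Vx] [Uy Vy].
by split; [apply: UP|apply: VP].
Qed.

Lemma submodule0 : submodule [set 0].
Proof. by split=> // a x y /= -> ->; rewrite scaler0 addr0. Qed.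

Lemma submoduleT : submodule setT.
Proof. by []. Qed.

Definition addset U V : set M := [set x | exists2 u, U u & V (x - u)].

Fixpoint lspan s : set M :=
  if s is g :: s' then [set x | exists c, lspan s' (x - c *: g)] else [set 0].

Lemma submodule_lspan s : submodule (lspan s).
Proof.
elim: s => [|g s [s0 sP]] /=; first exact: submodule0.
split; first by exists 0; rewrite scale0r subr0.
move=> a x y [c sc] [d sd]; exists (a * c + d).
by rewrite scalerDl -scalerA opprD addrACA -scalerBr; apply: sP.
Qed.

Lemma lspan_cons g s : lspan s `<=` lspan (g :: s).
Proof. by move=> x sx; exists 0; rewrite scale0r subr0. Qed.

Lemma mem_lspan s x : x \in s -> lspan s x.
Proof.
elim: s => // g s IH; rewrite inE => /predU1P[->|/IH]; last exact: lspan_cons.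
by exists 1; rewrite scale1r subrr; case: (submodule_lspan s).
Qed.

Lemma lspan_sub s U : submodule U -> (forall x, x \in s -> U x) ->
  lspan s `<=` U.
Proof.
move=> sU; elim: s => [|g s IH] sUs x /=; first by move=> ->; case: sU.
case=> c; move=> /IH sx; rewrite -(subrK (c *: g) x).
apply: submoduleD => //.
  by apply: sx => y ys; apply: sUs; rewrite inE ys orbT.
apply: submoduleZ => //; apply: sUs; exact: mem_head.
Qed.

Lemma lspan_mono s t : {subset s <= t} -> lspan s `<=` lspan t.
Proof.
by move=> st; apply: lspan_sub (submodule_lspan t) _ => x /st; apply: mem_lspan.
Qed.

Definition fgset U : Prop := exists s, U = lspan s.

Lemma fgset_sub U s : submodule U -> (forall x, x \in s -> U x) ->
  U `<=` lspan s -> fgset U.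
Proof.
by move=> sU sUs Us; exists s; apply/seteqP; split=> //; apply: lspan_sub.
Qed.

Definition noetherian : Prop := forall U, submodule U -> fgset U.

Definition dcc : Prop := forall U : nat -> set M,
  (forall n, submodule (U n)) -> (forall n, U n.+1 `<=` U n) ->
  exists n, forall m, (n <= m)%N -> U m = U n.

Lemma artinian_dcc : artinian M -> dcc.
Proof.
move=> dM U sU dU; have [n|n x|n nP] := dM (fun n => in_set (U n)).
- exact: submodule_closed (sU n).
- by rewrite !inE; apply: dU.
exists n => m /nP e; apply/seteqP; split=> x Ux; apply/set_mem.
  by have := e x; rewrite (mem_set Ux) => <-.
by have := e x; rewrite (mem_set Ux) => ->.
Qed.

(** The minimum principle: iterating a choice of strictly smaller members of [C]
would give a strictly descending chain. *)
Lemma dcc_min (C : set (set M)) : dcc -> C `<=` submodule -> C !=set0 ->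
  exists2 U, C U & forall V, C V -> V `<=` U -> V = U.
Proof.
move=> dM sC [U0 CU0]; apply: contrapT => noMin.
have /choice[F FP] U : exists V, C U -> [/\ C V, V `<=` U & V <> U].
  have [CU|nCU] := pselect (C U); last by exists U.
  apply: contrapT => nV; apply: noMin; exists U => // V CV VU.
  by apply: contrapT => VneU; apply: nV; exists V.
have CF n : C (iter n F U0) by elim: n => //= n /FP[].
have [n|n|n nP] := dM (fun n => iter n F U0); first exact/sC/CF.
  by have [] := FP _ (CF n).
by have [_ _] := FP _ (CF n); apply; apply: (nP n.+1).
Qed.

(** The union of the chain is finitely generated, and its finitely many
generators already lie in one term. *)
Lemma noetherian_acc (U : nat -> set M) : noetherian ->
  (forall n, submodule (U n)) -> (forall n, U n `<=` U n.+1) ->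
  exists n, forall m, (n <= m)%N -> U m = U n.
Proof.
move=> nM sU iU.
have mono n m : (n <= m)%N -> U n `<=` U m.
  by move=> /subnK <-; elim: (m - n)%N => //= d IH x /IH; apply: iU.
have [|s sE] := nM (\bigcup_n U n).
  split; first by exists 0%N => //; case: (sU 0%N).
  move=> a x y [n _ Ux] [m _ Uy]; exists (maxn n m) => //.
  by have [_] := sU (maxn n m); apply; [apply: mono Ux|apply: mono Uy];
    rewrite ?leq_maxl ?leq_maxr.
have [n nP] : exists n, forall x, x \in s -> U n x.
  have : forall x, x \in s -> (\bigcup_n U n) x.
    by rewrite sE => x; apply: mem_lspan.
  elim: (s) => [|g t IH] sUt; first by exists 0%N.
  have [x xt|n nP] := IH; first by apply: sUt; rewrite inE xt orbT.
  have [m _ mP] := sUt g (mem_head _ _); exists (maxn n m) => x.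
  rewrite inE => /predU1P[->|/nP Ux]; [apply: mono mP|apply: mono Ux];
    by rewrite ?leq_maxl ?leq_maxr.
exists n => m nm; apply/seteqP; split; last exact: mono.
move=> x Ux; apply: (lspan_sub (sU n) nP); rewrite -sE; by exists m.
Qed.

End Submodules.

(** * Finitely generated modules over rings with chain conditions *)

Section FgModules.
Variables (R : nzRingType) (M : lmodType R).
Implicit Types (U V : set M) (s : seq M).

(** The ideal of coefficients of [g] in the elements of [U], computed modulo the
span of [s].  Together with the intersection of [U] and the span of [s], it
controls [U] inside the span of [g :: s]; this is the induction step in the next
two results. *)
Definition leading_coefs (U : set M) g s : set R^o :=
  [set c | exists2 u, U u & lspan s (u - (c : R) *: g)].

Lemma submodule_leading_coefs U g s :
  submodule U -> submodule (leading_coefs U g s).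
Proof.
move=> [U0 UP]; have [s0 sP] := submodule_lspan s.
split; first by exists 0; rewrite // scale0r subr0.
move=> a c d [u Uu su] [v Uv sv]; exists (a *: u + v); first exact: UP.
by rewrite scalerDl -scalerA opprD addrACA -scalerBr; apply: sP.
Qed.

(** As in the Hilbert basis argument, generators of [U] are obtained by lifting
generators of the ideal of leading coefficients and adding generators of the
part of [U] in the span of the remaining elements. *)
Lemma noetherian_lspan s U : noetherian R^o -> submodule U -> U `<=` lspan s ->
  fgset U.
Proof.
move=> nR; elim: s U => [|g s IH] U sU Us.
  by apply: (@fgset_sub _ _ _ [::]).
have [t tE] := nR _ (submodule_leading_coefs g s sU).
have [|us usE] := IH (U `&` lspan s) _ (@subIsetr _ _ _).
  exact: submoduleI (submodule_lspan s).
have [vs vsU vsP] : exists2 vs, forall x, x \in vs -> U x &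
    forall c, lspan t c -> exists2 v, lspan vs v & lspan s (v - (c : R) *: g).
  have : forall c, c \in t -> leading_coefs U g s c.
    by rewrite tE; apply: mem_lspan.
  elim: (t) => [|c t' IHt] tP.
    by exists [::] => // c /= ->; exists 0 => //; rewrite scale0r subrr;
      case: (submodule_lspan s).
  have [d dt|vs vsU vsP] := IHt; first by apply: tP; rewrite inE dt orbT.
  have [v Uv sv] := tP c (mem_head _ _); exists (v :: vs).
    by move=> x; rewrite inE => /predU1P[->|/vsU].
  move=> d [e /vsP[w vw sw]]; exists (e *: v + w).
    by exists e; rewrite addrC addKr.
  have -> : e *: v + w - d *: g = e *: (v - c *: g) + (w - (d - e *: c) *: g).
    rewrite scalerBr scalerBl scalerA opprB addrACA; congr (_ + _).
    exact: esym (addKr _ _).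
  by case: (submodule_lspan s) => _; apply.
apply: (@fgset_sub _ _ _ (us ++ vs)) => // x.
  rewrite mem_cat => /orP[xus|/vsU //].
  by have: lspan us x := mem_lspan xus; rewrite -usE => -[].
move=> Ux; have /= [c sxc] := Us _ Ux.
have /vsP[v vv sv] : lspan t (c : R^o) by rewrite -tE; exists x.
rewrite -(subrK v x); apply: submoduleD; first exact: submodule_lspan.
  have : lspan us (x - v).
    rewrite -usE; split; first apply: submoduleB => //.
      exact: lspan_sub vv.
    have -> : x - v = (x - c *: g) - (v - c *: g) by rewrite opprB addrA subrK.
    by apply: submoduleB => //; apply: submodule_lspan.
  by apply: lspan_mono => y yus; rewrite mem_cat yus.
by apply: lspan_mono vv => y yus; rewrite mem_cat yus orbT.
Qed.

(** A descending chain stabilises once its ideals of leading coefficients and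
its intersections with the span of the remaining elements do. *)
Lemma dcc_lspan s (U : nat -> set M) : dcc R^o ->
  (forall n, submodule (U n)) -> (forall n, U n.+1 `<=` U n) ->
  U 0%N `<=` lspan s ->
  exists n, forall m, (n <= m)%N -> U m = U n.
Proof.
move=> dR; elim: s U => [|g s IH] U sU dU U0s.
  have U0 n : U n = [set 0].
    apply/seteqP; split=> [|x ->]; last by case: (sU n).
    by elim: n => [|n IHn] //= x /dU /IHn.
  by exists 0%N => m _; rewrite !U0.
have mono n m : (n <= m)%N -> U m `<=` U n.
  by move=> /subnK <-; elim: (m - n)%N => //= d IHd x /dU; apply: IHd.
have [n|n|n1 n1P] := dR (fun n => leading_coefs (U n) g s).
- exact: submodule_leading_coefs.
- by move=> c [u /dU Uu su]; exists u.
have [n|n|x []//|n2 n2P] := IH (fun n => U n `&` lspan s).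
- exact: submoduleI (submodule_lspan s).
- by move=> x [/dU].
exists (maxn n1 n2) => m; rewrite geq_max => /andP[n1m n2m].
apply/seteqP; split; first by apply: mono; rewrite geq_max n1m.
set n := maxn n1 n2 => x Ux.
have [c sc] := U0s x (mono 0%N n (leq0n _) _ Ux).
have : leading_coefs (U n) g s c by exists x.
rewrite n1P ?leq_maxl// -(n1P m)// => -[v Uv sv].
have Un2 : (U n2 `&` lspan s) (x - v).
  split; last first.
    have -> : x - v = (x - c *: g) - (v - c *: g) by rewrite opprB addrA subrK.
    by apply: submoduleB => //; apply: submodule_lspan.
  by apply: submoduleB => //; [apply: mono Ux; rewrite leq_maxr|apply: mono Uv].
move: Un2; rewrite -(n2P m)// => -[Uxv _].
by rewrite -(subrK v x); apply: submoduleD.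
Qed.

End FgModules.

(** * Images and kernels; Artinian commutative rings are Noetherian *)

Section Extension.
Variables (R : nzRingType) (M N : lmodType R) (f : {linear M -> N}).

Lemma submodule_ker : submodule [set x | f x = 0].
Proof.
split=> /=; first exact: linear0.
by move=> a x y fx fy; rewrite linearP fx fy scaler0 addr0.
Qed.

Lemma submodule_image (U : set M) : submodule U -> submodule (f @` U).
Proof.
move=> [U0 UP]; split; first by exists 0; rewrite ?linear0.
move=> a _ _ [x Ux <-] [y Uy <-]; exists (a *: x + y); first exact: UP.
by rewrite linearP.
Qed.

Lemma submodule_preimage (U : set N) : submodule U -> submodule (f @^-1` U).
Proof.
move=> [U0 UP]; split; first by rewrite /= linear0.
by move=> a x y Ux Uy; rewrite /= linearP; apply: UP.
Qed.

Lemma lspan_lift (U : set M) (t : seq N) : (forall y, y \in t -> (f @` U) y) ->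
  exists2 s, forall x, x \in s -> U x &
    forall y, lspan t y -> exists2 x, lspan s x & f x = y.
Proof.
elim: t => [|y t IH] tU.
  by exists [::] => // y /= ->; exists 0; rewrite ?linear0.
have [z zt|s sU sP] := IH; first by apply: tU; rewrite inE zt orbT.
have [x Ux fx] := tU y (mem_head _ _); exists (x :: s).
  by move=> z; rewrite inE => /predU1P[->|/sU].
move=> z [c /sP[w sw fw]]; exists (c *: x + w).
  by exists c; rewrite addrC addKr.
by rewrite linearP fx fw addrC subrK.
Qed.

Lemma fgset_extension (U : set M) : submodule U ->
  fgset (f @` U) -> fgset (U `&` [set x | f x = 0]) -> fgset U.
Proof.
move=> sU [t tE] [r rE].
have [y|s sU' sP] := @lspan_lift U t; first by rewrite tE; apply: mem_lspan.
have rU x : lspan r x -> U x by rewrite -rE => -[].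
apply: (@fgset_sub _ _ _ (r ++ s)) => // x.
  by rewrite mem_cat => /orP[/mem_lspan/rU|/sU'].
move=> Ux; have [|z sz fz] := sP (f x); first by rewrite -tE; exists x.
rewrite -(subrK z x); apply: submoduleD; first exact: submodule_lspan.
  apply: (@lspan_mono _ _ r) => [y yr|]; first by rewrite mem_cat yr.
  rewrite -rE; split; last by rewrite /= linearB fz subrr.
  by apply: submoduleB => //; apply: lspan_sub sz.
by apply: lspan_mono sz => y ys; rewrite mem_cat ys orbT.
Qed.

End Extension.

(** Let [Y] be minimal among the ideals that are not finitely generated, so that
all ideals strictly inside [Y] are finitely generated.  Each [a] kills [Y] or
maps [Y] onto itself, for otherwise both the kernel and the image of
multiplication by [a] on [Y] are finitely generated, and so is [Y].  In the
second case [a] is invertible on [Y], by the descending chain condition for the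
ideals generated by the powers of [a]: thus [Y] is a vector space over a field.
A complement [Z] of the line through a nonzero [y0] is a proper submodule, hence
finitely generated, and so [Y] is finitely generated after all. *)
Lemma artinian_noetherian (k : comNzRingType) : dcc k^o -> noetherian k^o.
Proof.
move=> dk; apply: contrapT => /existsNP[U0 /not_implyP[sU0 nfgU0]].
have [||Y [sY nfgY] minY] :=
    @dcc_min _ _ [set U : set k^o | submodule U /\ ~ fgset U] dk.
- by move=> U [].
- by exists U0.
have fgprop V : submodule V -> V `<=` Y -> V <> Y -> fgset V.
  by move=> sV VY VneY; apply: contrapT => nfg; apply/VneY/minY.
have mulL (a : k) : linear (fun x : k^o => a * x : k^o).
  by move=> b x y; rewrite mulrDr [b *: x]/(b * x) mulrCA.
pose mul a := mklin (mulL a).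
have dicho a : (forall y, Y y -> a * y = 0) \/
    (forall y, Y y -> exists2 z, Y z & y = a * z).
  have sI : submodule (mul a @` Y) by exact: submodule_image.
  have sK : submodule (Y `&` [set x | mul a x = 0]).
    exact/submoduleI/submodule_ker.
  have [eK|neK] := pselect (Y `&` [set x | mul a x = 0] = Y).
    by left=> y; rewrite -eK => -[].
  have [eI|neI] := pselect (mul a @` Y = Y).
    by right=> y; rewrite -{1}eI => -[z Yz <-]; exists z.
  case: nfgY; apply: (@fgset_extension _ _ _ (mul a)) => //.
    by apply: fgprop neI => // _ [y Yy <-]; apply: submoduleZ.
  by apply: fgprop neK => // y [].
(* from a ^+ n = a ^+ n.+1 * b and y = a ^+ n * z one gets b * (a * y) = y *)
have inv a y1 : Y y1 -> a * y1 <> 0 ->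
    exists b, forall y, Y y -> b * (a * y) = y.
  move=> Yy1 ay1; have [/(_ _ Yy1)//|onto] := dicho a.
  have [n|n|n nP] := dk (fun n => range (mul (a ^+ n))).
  - exact/submodule_image.
  - by move=> _ [c _ <-]; exists (a * c); rewrite //= exprSr mulrA.
  have : range (mul (a ^+ n)) (a ^+ n) by exists 1; rewrite //= mulr1.
  rewrite -(nP n.+1)// => -[b _ /= ab]; exists b.
  have divn m y : Y y -> exists2 z, Y z & y = a ^+ m * z.
    elim: m y => [|m IH] y Yy; first by exists y; rewrite ?mul1r.
    have [z Yz ->] := onto _ Yy; have [w Yw ->] := IH _ Yz.
    by exists w; rewrite // exprS mulrA.
  move=> y /(divn n)[z _ ->]; rewrite -{2}ab.
  by rewrite [b * _]mulrC !mulrA -exprS mulrAC.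
have [y0 Yy0 y0N0] : exists2 y0, Y y0 & y0 <> 0.
  apply: contrapT => nY; apply: nfgY; exists [::]; apply/seteqP; split=> /= y.
    by move=> Yy; apply: contrapT => yN0; apply: nY; exists y.
  by move=> ->; case: sY.
(* The complement is found as a maximal submodule avoiding y0; membership of 0
   is left out of the Zorn condition so that the empty chain causes no trouble.
   *)
have [|Z [[ZY ZP Zy0] maxZ]] := @Zorn_bigcup _ [set U : set k^o |
    [/\ U `<=` Y, forall a x y, U x -> U y -> U (a *: x + y) & ~ U y0]].
  move=> F FP totF; split.
  - by move=> x [U FU Ux]; have [+ _ _] := FP _ FU; apply.
  - move=> a x y [U FU Ux] [V FV Vy].
    have [UV|VU] := totF _ _ FU FV; [exists V|exists U] => //.
      by have [_ + _] := FP _ FV; apply => //; apply: UV.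
    by have [_ + _] := FP _ FU; apply => //; apply: VU.
  - by move=> [U FU]; have [_ _] := FP _ FU.
have [s0 sP] := @submodule0 _ k^o.
have Z0 : Z 0.
  apply: contrapT => nZ0; apply: (maxZ [set 0]).
    split; last by move=> /(_ 0 erefl).
    move=> z Zz; case: nZ0; rewrite -(subrr z) addrC -scaleN1r; exact: ZP.
  by split=> // x ->; case: sY.
have sZ : submodule Z by [].
have [|s sE] := fgprop _ sZ ZY; first by move=> e; apply: Zy0; rewrite e.
apply: nfgY; apply: (@fgset_sub _ _ _ (y0 :: s)) => // x.
  by rewrite inE => /predU1P[->//|/mem_lspan]; rewrite -sE => /ZY.
move=> Yx; have [|nZx] := pselect (Z x); first by rewrite sE; apply: lspan_cons.
have [c sc] : lspan (x :: s) y0.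
  apply: contrapT => ny0; apply: (maxZ (lspan (x :: s))).
    split; first by rewrite sE; apply: lspan_cons.
    by move=> /(_ x (mem_lspan (mem_head _ _))).
  split=> //; last by have [] := submodule_lspan (x :: s).
  apply: lspan_sub => // y; rewrite inE => /predU1P[->//|/mem_lspan].
  by rewrite -sE; apply: ZY.
have [|b bP] := inv c x Yx.
  by move=> cx; apply: Zy0; rewrite sE -[y0]subr0 -[X in _ - X]cx.
exists b; have -> : x - b *: y0 = - b *: (y0 - c *: x).
  by rewrite scaleNr scalerBr opprB -{1}(bP x Yx).
by apply: submoduleZ => //; apply: submodule_lspan.
Qed.

(** * Modules of finite length over an Artin algebra *)

Section SubmoduleType.
Variables (R : nzRingType) (M : lmodType R) (U : set M).

Definition submodule_pred (sU : submodule U) : {pred M} := in_set U.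

Variable sU : submodule U.

HB.instance Definition _ := GRing.isSubmodClosed.Build R M (submodule_pred sU)
  (submodule_closed sU).

Record submodule_sort := SubmoduleSort {
  submodule_val : M; _ : submodule_val \in submodule_pred sU }.
HB.instance Definition _ := [isSub for submodule_val].
HB.instance Definition _ := [Choice of submodule_sort by <:].
HB.instance Definition _ := [SubChoice_isSubLmodule of submodule_sort by <:].

(** Submodules enter later constructions only through this description, as the
range of an injective linear map. *)
Lemma submodule_type : exists (N : lmodType R) (i : {linear N -> M}),
  injective i /\ range i = U.
Proof.
exists submodule_sort, (val : {linear submodule_sort -> M}); split.
  exact: val_inj.
apply/seteqP; split=> [_ [u _ <-]|x Ux]; first exact/set_mem/(valP u).
by exists (SubmoduleSort (mem_set Ux : x \in submodule_pred sU)).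
Qed.

End SubmoduleType.

Section FiniteLength.
Variable R : nzRingType.
Implicit Types M N : lmodType R.

(** The two chain conditions together are equivalent to having a composition
series. *)
Definition finite_length M := dcc M /\ noetherian M.

Lemma linear_image_inj M N (f : {linear M -> N}) : injective f ->
  injective (fun U : set M => f @` U).
Proof.
move=> fI U V e; apply/seteqP; split=> x Ux.
  by have : (f @` V) (f x) by [rewrite -e; exists x]; move=> [y Vy /fI<-].
by have : (f @` U) (f x) by [rewrite e; exists x]; move=> [y Vy /fI<-].
Qed.

Lemma finite_length_inj M N (f : {linear M -> N}) : injective f ->
  finite_length N -> finite_length M.
Proof.
move=> fI [dN nN]; split.
  move=> U sU dU; have [n|n|n nP] := dN (fun n => f @` U n).
  - exact: submodule_image.
  - by move=> _ [x /dU Ux <-]; exists x.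
  by exists n => m /nP /(linear_image_inj fI).
move=> U sU; apply: (@fgset_extension _ _ _ f) => //.
  exact/nN/submodule_image.
apply: (@fgset_sub _ _ _ [::]) => //; first exact/submoduleI/submodule_ker.
by move=> x [_ /= fx]; apply: fI; rewrite fx linear0.
Qed.

Lemma span_fg M : finitely_generated M <-> fgset [set: M].
Proof.
split=> [[n [v vP]]|[s sE]].
  apply: (@fgset_sub _ _ _ (codom v)) => // x _.
  have [c ->] := vP x; apply: submodule_sum; first exact: submodule_lspan.
  move=> i _; apply: submoduleZ; first exact: submodule_lspan.
  exact/mem_lspan/codom_f.
exists (size s), (fun i => s`_i) => x.
have: lspan s x by rewrite -sE.
elim: {sE} s x => [|g s IH] x /=.
  by move=> ->; exists (fun=> 0); rewrite big_ord0.
move=> [c /IH[d xE]].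
exists (fun i => oapp d c (unlift ord0 i)).
rewrite big_ord_recl /= unlift_none /= addrC.
apply/eqP; rewrite -subr_eq xE; apply/eqP; apply: eq_bigr => i _.
by rewrite liftK.
Qed.

Lemma fg_surj M N (f : {linear M -> N}) : surjective f ->
  finitely_generated M -> finitely_generated N.
Proof.
move=> fs [n [v vP]]; exists n, (f \o v) => y.
have [x <-] := fs y; have [c ->] := vP x; exists c.
by rewrite linear_sum; apply: eq_bigr => i _; rewrite linearZ.
Qed.

Lemma fg_prod M N : finitely_generated M -> finitely_generated N ->
  finitely_generated (M * N)%type.
Proof.
move=> /span_fg[s sE] /span_fg[t tE]; apply/span_fg.
pose r := [seq (x, 0) | x <- s] ++ [seq (0, y) | y <- t].
apply: (@fgset_sub _ _ _ r) => //.
move=> [x y] _.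
have -> : (x, y) = (x, 0) + (0, y) by congr pair; rewrite /= ?addr0 ?add0r.
apply: submoduleD; first exact: submodule_lspan.
  have : lspan s x by rewrite -sE.
  apply: lspan_sub (submodule_preimage (in1 M N) (submodule_lspan _)) _ _.
  by move=> u us; apply: mem_lspan; rewrite mem_cat map_f.
have : lspan t y by rewrite -tE.
apply: lspan_sub (submodule_preimage (in2 M N) (submodule_lspan _)) _ _.
by move=> u ut; apply: mem_lspan; rewrite mem_cat orbC map_f.
Qed.

End FiniteLength.

Section Restriction.
Variables (k : comNzRingType) (A : algType k) (M : lmodType A^c).

(** The carrier of [M], as a [k]-module through the central map from [k] to
[A]; the alias keeps the two module structures apart. *)
Definition restriction : Type := M.
HB.instance Definition _ := GRing.Zmodule.on restriction.

Definition restriction_scale (c : k) (x : restriction) : restriction :=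
  (c%:A : A^c) *: (x : M).

Fact restriction_scaleA a b v :
  restriction_scale a (restriction_scale b v) = restriction_scale (a * b) v.
Proof.
have e : b%:A * a%:A = (a * b)%:A :> A.
  by rewrite -scalerAl mul1r scalerA mulrC.
by rewrite /restriction_scale scalerA -e.
Qed.
Fact restriction_scale1 : left_id 1 restriction_scale.
Proof. by move=> x; rewrite /restriction_scale scale1r [_ *: _]scale1r. Qed.
Fact restriction_scaleDr : right_distributive restriction_scale +%R.
Proof. by move=> a x y; rewrite /restriction_scale scalerDr. Qed.
Fact restriction_scaleDl v : {morph restriction_scale^~ v : a b / a + b}.
Proof. by move=> a b; rewrite /restriction_scale !scalerDl. Qed.

HB.instance Definition _ := GRing.Zmodule_isLmodule.Build k restriction
  restriction_scaleA restriction_scale1 restriction_scaleDr restriction_scaleDl.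

Lemma submodule_restriction (U : set M) :
  submodule U -> submodule (U : set restriction).
Proof. by move=> [U0 UP]; split=> // a x y; apply: UP. Qed.

(** As a [k]-module, [M] is generated by the products of the generators of [A]
and those of [M], so both chain conditions hold for its [k]-submodules, and the
[A]-submodules are among these. *)
Lemma artin_finite_length :
  artin_algebra A -> finitely_generated M -> finite_length M.
Proof.
move=> [/artinian_dcc dk [n [a aP]]] [m [v vP]].
have nk := artinian_noetherian dk.
pose s : seq restriction := [seq (a p.1 : A^c) *: v p.2 | p : 'I_n * 'I_m].
have sT x : lspan s x.
  have [c ->] := vP x.
  apply: (@submodule_sum _ restriction); first exact: submodule_lspan.
  move=> j _; have [d ->] := aP (c j); rewrite scaler_suml.
  apply: (@submodule_sum _ restriction); first exact: submodule_lspan.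
  move=> i _; have -> : (d i *: a i : A^c) *: v j =
      (d i : k) *: ((a i : A^c) *: v j : restriction).
    have e : a i * (d i)%:A = d i *: a i :> A by rewrite -scalerAr mulr1.
    by rewrite [RHS]scalerA -e.
  apply: submoduleZ; first exact: submodule_lspan.
  by apply: mem_lspan; apply/mapP; exists (i, j); rewrite ?mem_enum.
split.
  move=> U sU dU; apply: (@dcc_lspan _ restriction s) => // n'.
  exact: submodule_restriction.
move=> U sU.
have [|//|t tE] := @noetherian_lspan _ restriction s U nk.
  exact: submodule_restriction.
have tU (x : M) : x \in (t : seq M) -> U x.
  by rewrite tE; apply: (@mem_lspan _ restriction).
apply: (@fgset_sub _ M U t) => // x; rewrite {1}tE.
apply: (@lspan_sub _ restriction); last exact: (@mem_lspan _ M).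
exact/submodule_restriction/(@submodule_lspan _ M).
Qed.

End Restriction.

(** * Isomorphisms and direct sums *)

Section Isomorphisms.
Variable R : nzRingType.
Implicit Types M N P Q : lmodType R.

Lemma inj_surj_bij (S T : Type) (f : S -> T) :
  injective f -> (forall y, exists x, f x = y) -> bijective f.
Proof.
move=> fI /choice[g gP]; exists g => // x.
exact/fI/gP.
Qed.

Lemma linear_inj M N (f : {linear M -> N}) :
  (forall x, f x = 0 -> x = 0) -> injective f.
Proof.
move=> f0 x y e; apply/eqP; rewrite -subr_eq0; apply/eqP/f0.
by rewrite linearB e subrr.
Qed.

Lemma linear_can M N (f : {linear M -> N}) g :
  cancel f g -> cancel g f -> linear g.
Proof. by move=> fK gK a u v; apply: (can_inj fK); rewrite linearP !gK. Qed.

Lemma iso_mk M N (f : M -> N) g : linear f -> cancel f g -> cancel g f ->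
  isomorphic M N.
Proof. by move=> fL fK gK; exists (mklin fL); exists g. Qed.

Lemma iso_refl M : isomorphic M M.
Proof. by exists idfun; exists idfun. Qed.

Lemma iso_sym M N : isomorphic M N -> isomorphic N M.
Proof.
by move=> [f [g fK gK]]; exact: (iso_mk (linear_can fK gK) gK fK).
Qed.

Lemma iso_trans N M P : isomorphic M N -> isomorphic N P -> isomorphic M P.
Proof.
move=> [f fB] [g gB]; exists (g \o f : {linear M -> P}); exact: bij_comp.
Qed.

Lemma iso_prod M M' N N' : isomorphic M M' -> isomorphic N N' ->
  isomorphic (M * N)%type (M' * N')%type.
Proof.
move=> [f [f' fK f'K]] [g [g' gK g'K]].
apply: (@iso_mk _ _ (fun p => (f p.1, g p.2)) (fun p => (f' p.1, g' p.2))).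
- by move=> a u v; congr pair; rewrite /= linearP.
- by case=> x y /=; rewrite fK gK.
- by case=> x y /=; rewrite f'K g'K.
Qed.

Lemma iso_prodC M N : isomorphic (M * N)%type (N * M)%type.
Proof.
by apply: (@iso_mk _ _ (fun p => (p.2, p.1)) (fun p => (p.2, p.1)))
  => [a|[]|[]].
Qed.

Lemma iso_prodA M N P : isomorphic (M * (N * P))%type ((M * N) * P)%type.
Proof.
by apply: (@iso_mk _ _ (fun p => (p.1, p.2.1, p.2.2))
  (fun p => (p.1.1, (p.1.2, p.2)))) => [a|[? []]|[[]]].
Qed.

Lemma iso_prod0 M N : zero_module M -> isomorphic (M * N)%type N.
Proof.
move=> M0; apply: (@iso_mk _ _ snd (fun y => (0, y))) => [a|[x y]|] //=.
by rewrite (M0 x).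
Qed.

Lemma iso_prodAC M N P : isomorphic (M * N * P)%type (M * P * N)%type.
Proof.
apply: iso_trans (iso_sym (iso_prodA _ _ _)) _.
apply: iso_trans (iso_prodA _ _ _).
exact/iso_prod/iso_prodC/iso_refl.
Qed.

Lemma iso_prodCA M N P : isomorphic (M * (N * P))%type (N * (M * P))%type.
Proof.
apply: iso_trans (iso_prodA _ _ _) _.
apply: iso_trans (iso_sym (iso_prodA _ _ _)).
exact/iso_prod/iso_refl/iso_prodC.
Qed.

Lemma iso_prodACA M N P Q :
  isomorphic ((M * N) * (P * Q))%type ((M * P) * (N * Q))%type.
Proof.
apply: iso_trans (iso_sym (iso_prodA _ _ _)) _.
apply: iso_trans (iso_prodA _ _ _).
exact/iso_prod/iso_prodCA/iso_refl.
Qed.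

Lemma indecomposable_internal M (U V : set M) : indecomposable M ->
  submodule U -> submodule V -> U `&` V `<=` [set 0] ->
  addset U V = setT -> U `<=` [set 0] \/ V `<=` [set 0].
Proof.
move=> [_ indM] sU sV UV0 UVT.
have [N [i [iI iU]]] := submodule_type sU.
have [N' [j [jI jV]]] := submodule_type sV.
have fL : linear (fun p : N * N' => i p.1 + j p.2).
  by move=> a u v; rewrite /= !linearP scalerDr addrACA.
have [|N0|N0] := indM N N'.
- apply: iso_sym; exists (mklin fL); apply: inj_surj_bij.
    apply: linear_inj => -[x y] /= /eqP; rewrite addr_eq0 => /eqP e.
    have ix : i x = 0.
      apply: UV0; split; first by rewrite -iU; exists x.
      by rewrite e; apply: submoduleN => //; rewrite -jV; exists y.
    congr pair; first by apply: iI; rewrite linear0.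
    by apply: jI; rewrite linear0; apply/eqP; rewrite -oppr_eq0 -e ix.
  move=> x; have : addset U V x by rewrite UVT.
  rewrite -iU -jV => -[_ [y _ <-]] [z _ jz]; exists (y, z).
  by rewrite /= jz addrC subrK.
- by left; rewrite -iU => _ [x _ <-]; rewrite (N0 x) /= linear0.
- by right; rewrite -jV => _ [x _ <-]; rewrite (N0 x) /= linear0.
Qed.

End Isomorphisms.

(** * Fitting's lemma and cancellation *)

Section Fitting.
Variables (R : nzRingType) (W : lmodType R).
Hypotheses (flW : finite_length W) (indW : indecomposable W).

(** For large [m] the module is the direct sum of the kernel and the range of
[f ^ m], and indecomposability makes one of them zero. *)
Lemma fitting (f : {linear W -> W}) :
  bijective f \/ exists n, forall x, iter n f x = 0.
Proof.
have [dW nW] := flW; pose g n := mklin (iter_linear f n).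
have [n|n|n1 n1P] := @noetherian_acc _ _ (fun n => [set x | g n x = 0]) nW.
- exact: submodule_ker.
- by move=> x /= ->; rewrite linear0.
have [n|n|n2 n2P] := dW (fun n => range (g n)).
- exact: submodule_image.
- by move=> _ [x _ <-]; exists (f x); rewrite //= -iterSr.
(* The successor makes m positive, so that injectivity or surjectivity of the
   m-th iterate passes to f. *)
pose m := (maxn n1 n2).+1.
have n1m : (n1 <= m)%N by rewrite leqW ?leq_maxl.
have n2m : (n2 <= m)%N by rewrite leqW ?leq_maxr.
have fmB x y : iter m f (x - y) = iter m f x - iter m f y := linearB (g m) x y.
have kerm x : iter (m + m) f x = 0 -> iter m f x = 0.
  have -> : (iter m f x = 0) = [set x | g m x = 0] x by [].
  by rewrite n1P // -(n1P (m + m)%N) // (leq_trans n1m) ?leq_addr.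
have imm x : exists y, iter m f x = iter (m + m) f y.
  have : range (g m) (g m x) by exists x.
  rewrite n2P // -(n2P (m + m)%N).
    by move=> [y _ e]; exists y; exact: esym e.
  by rewrite (leq_trans n2m) ?leq_addr.
have [||x [kx [z _ gz]]||k0|i0] := @indecomposable_internal _ _
    [set x | g m x = 0] (range (g m)) indW.
- exact: submodule_ker.
- exact: submodule_image.
- by rewrite /= -gz; apply: kerm; rewrite iterD -[iter m f z]/(g m z) gz.
- apply/seteqP; split=> // x _; have [y xy] := imm x.
  exists (x - iter m f y); last by exists y => //; rewrite opprB addrC subrK.
  by apply: etrans (fmB _ _) _; rewrite xy -iterD subrr.
- left; apply: inj_surj_bij.
    apply: linear_inj => x fx; apply: k0.
    apply: etrans (iterSr _ f x : iter m f x = iter m.-1 f (f x)) _.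
    by rewrite fx; apply: (linear0 (g m.-1)).
  move=> x; have [y xy] := imm x; exists (iter m.-1 f y).
  apply/eqP; rewrite eq_sym -subr_eq0 -[f _]/(iter m f y); apply/eqP/k0.
  by apply: etrans (fmB _ _) _; rewrite xy -iterD subrr.
- by right; exists m => x; apply: i0; exists x.
Qed.

Lemma fitting_inj (f : {linear W -> W}) : injective f -> bijective f.
Proof.
move=> fI; have [//|[n fn0]] := fitting f.
case: indW => W0 _; case: W0 => x; have := fn0 x.
elim: n {fn0} => //= n IH fx0; apply: IH; apply: fI.
by rewrite fx0 linear0.
Qed.

End Fitting.

Section Cancellation.
Variable R : nzRingType.
Implicit Types M N W U V : lmodType R.

(** Gaussian elimination for block matrices: if the corner of [h] at [W] is
invertible, then [u] has a unique lift to the kernel of the [W]-component of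
[h], and the [V]-component on these lifts is the Schur complement. *)
Lemma schur_complement W U V (h : {linear (W * U)%type -> (W * V)%type}) :
  bijective h -> bijective (fun w => (h (w, 0)).1) -> isomorphic U V.
Proof.
move=> [h' hK h'K] [a' aK a'K].
have hD w u : h (w, u) = h (w, 0) + h (0, u).
  by rewrite -linearD; congr (h _); congr pair; rewrite /= ?addr0 ?add0r.
have h1 u w : (h (w, u)).1 = 0 <-> w = a' (- (h (0, u)).1).
  rewrite hD /=; split=> [e|->]; last by rewrite a'K addNr.
  by rewrite -[LHS]aK; congr a'; apply/eqP; rewrite -addr_eq0 e.
pose c u := a' (- (h (0, u)).1).
have cL : linear c.
  move=> r u v; apply/esym/h1.
  have -> : (r *: c u + c v, r *: u + v) = r *: (c u, u) + (c v, v) by [].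
  have hu : (h (c u, u)).1 = 0 by apply/h1.
  have hv : (h (c v, v)).1 = 0 by apply/h1.
  by rewrite linearP /= hu hv scaler0 addr0.
have gL : linear (fun u => (h (c u, u)).2).
  move=> r u v; rewrite cL.
  have -> : (r *: c u + c v, r *: u + v) = r *: (c u, u) + (c v, v) by [].
  by rewrite linearP.
exists (mklin gL); apply: inj_surj_bij.
  apply: linear_inj => u /= hu2.
  have hu1 : (h (c u, u)).1 = 0 by apply/h1.
  have : h (c u, u) = 0 by rewrite [h _]surjective_pairing hu1 hu2.
  move=> e; have [//] : (c u, u) = 0.
  by rewrite -(hK (c u, u)) e -(linear0 h) hK.
move=> v; case e: (h' (0, v)) => [w u]; exists u => /=.
have hwu : h (w, u) = (0, v) by rewrite -e h'K.
have -> : c u = w by apply/esym/h1; rewrite hwu.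
by rewrite hwu.
Qed.

Definition cancellable W := forall U V,
  isomorphic (W * U)%type (W * V)%type -> isomorphic U V.

(** Write the isomorphism as a block matrix with entries [a : W -> W] and [c :
W -> V] on [W], and its inverse with first row [a'], [b'], so that [a' a + b' c
= 1]. If [a] is invertible, its Schur complement is an isomorphism. Otherwise
[a] is nilpotent; then so is [a' a], so that [b' c] is invertible and [a + b'
c] as well. Composing with the shear of [W * V] defined by [b'] replaces [a] by
[a + b' c], which reduces to the first case. *)
Lemma cancel_indecomposable W :
  finite_length W -> indecomposable W -> cancellable W.
Proof.
move=> flW indW U V [h hB]; have [h' hK h'K] := hB.
pose H' := mklin (linear_can hK h'K).
pose a : {linear W -> W} := fst \o (h \o in1 W U).
pose c : {linear W -> V} := snd \o (h \o in1 W U).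
pose a' : {linear W -> W} := fst \o (H' \o in1 W V).
pose b' : {linear V -> W} := fst \o (H' \o in2 W V).
have [aB|[n an0]] := fitting flW indW a; first exact: schur_complement aB.
have split1 w : a' (a w) + b' (c w) = w.
  have e : H' (in1 W V (a w)) + H' (in2 W V (c w)) = (w, 0).
    rewrite -linearD -[RHS]hK; congr (h' _); rewrite [RHS]surjective_pairing.
    by congr pair; rewrite /= ?addr0 ?add0r.
  by have /= := congr1 fst e.
have Wn0 : exists w : W, w <> 0.
  apply: contrapT => nW; case: indW => + _; apply=> x.
  by apply: contrapT => xN0; apply: nW; exists x.
have aNinj : ~ injective a.
  move=> aI; have [w wN0] := Wn0; apply: wN0; have := an0 w.
  by elim: n {an0} => //= m IH e; apply/IH/aI; rewrite linear0.
(* a' a is not injective, hence nilpotent, and b' c = 1 - a' a is injective *)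
have eB : bijective (b' \o c : {linear W -> W}).
  have [gB|[m gm0]] := fitting flW indW (a' \o a : {linear W -> W}).
    by case: aNinj; apply: (inj_compr (f := a')); exact: bij_inj gB.
  apply: fitting_inj => //; apply: linear_inj => x bc0.
  have ax : a' (a x) = x by rewrite -[RHS]split1 [b' (c x)]bc0 addr0.
  by rewrite -(gm0 x); elim: m {gm0} => //= m IH; rewrite -IH.
have [e' eK e'K] := eB; have e'L := linear_can eK e'K; pose E' := mklin e'L.
have shearB : bijective (fun p : W * V => (p.1 + b' p.2, p.2)).
  exists (fun p : W * V => (p.1 - b' p.2, p.2)) => -[x y] /=.
    by rewrite addrK.
  by rewrite subrK.
have shearL : linear (fun p : W * V => (p.1 + b' p.2, p.2)).
  move=> r x y; congr pair.
  have e : r *: x.1 + y.1 + b' (r *: x.2 + y.2) =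
      r *: (x.1 + b' x.2) + (y.1 + b' y.2).
    by rewrite linearP scalerDr addrACA.
  exact: e.
apply: (@schur_complement W U V (mklin shearL \o h : {linear _ -> _})).
  exact: bij_comp.
apply: (fitting_inj flW indW (f := (a \+ (b' \o c) : {linear W -> W}))).
apply: linear_inj => x e0.
have [qB|[m qm0]] := fitting flW indW (E' \o a : {linear W -> W}).
  by case: aNinj; apply: (inj_compr (f := E')); exact: bij_inj qB.
(* q = (b' c)^-1 a is nilpotent, but an x killed by a + b' c satisfies q x = -
   x *)
have qx : E' (a x) = - x.
  have Ebc : E' (b' (c x)) = x := eK x.
  apply/eqP; rewrite -addr_eq0 -[X in _ + X]Ebc -linearD; apply/eqP.
  by rewrite -[RHS](linear0 E'); congr (E' _).
have qmx i : iter i (E' \o a) x = (-1) ^+ i *: x.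
  elim: i => [|i IH]; first by rewrite scale1r.
  have Ea r y : E' (a (r *: y)) = r *: E' (a y) by rewrite !linearZ.
  by rewrite iterS IH [LHS]Ea qx exprS -scalerA scaleN1r scalerN.
have := qm0 x; rewrite qmx => /(congr1 (fun y => (-1) ^+ m *: y)).
by rewrite scalerA -expr2 sqrr_sign scale1r scaler0.
Qed.

Lemma cancel_prod W W' : cancellable W -> cancellable W' ->
  cancellable (W * W')%type.
Proof.
move=> cW cW' U V i; apply/cW'/cW.
exact: iso_trans (iso_prodA _ _ _) (iso_trans i (iso_sym (iso_prodA _ _ _))).
Qed.

Lemma cancel_iso W W' : isomorphic W W' -> cancellable W' -> cancellable W.
Proof.
move=> i cW' U V j; apply: cW'.
apply: iso_trans (iso_prod (iso_sym i) (iso_refl _)) (iso_trans j _).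
exact: iso_prod i (iso_refl _).
Qed.

Lemma cancel_zero W : zero_module W -> cancellable W.
Proof.
move=> W0 U V i; apply: iso_trans (iso_prod0 V W0).
exact: iso_trans (iso_sym (iso_prod0 U W0)) i.
Qed.

End Cancellation.

(** * Projective covers, syzygies and decompositions *)

Section FiniteLengthModules.
Variable A : nzRingType.
Implicit Types M N P Q : fgmod A.

Definition fg_prod_mod M N : fgmod A := FgMod (fg_prod (fgmodP M) (fgmodP N)).

Lemma fg_free n : finitely_generated 'rV[A^c]_n.
Proof.
exists n, (fun i => delta_mx 0 i) => x; exists (fun i => x 0 i).
exact: row_sum_delta.
Qed.

Definition free_mod n : fgmod A := FgMod (fg_free n).
Definition zero_mod : fgmod A := free_mod 0.

Lemma zero_modP : zero_module zero_mod.
Proof. by move=> x; apply/rowP => -[]. Qed.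

Lemma fg_iso (M N : lmodType A^c) : isomorphic M N ->
  finitely_generated M -> finitely_generated N.
Proof.
by move=> [f [g _ gK]]; apply: (fg_surj (f := f)) => y; exists (g y).
Qed.

Lemma fg_summand (M N N' : lmodType A^c) : isomorphic M (N * N')%type ->
  finitely_generated M -> finitely_generated N.
Proof.
move=> i /(fg_iso i); apply: (fg_surj (f := fst : {linear (N * N')%type -> N})).
by move=> y; exists (y, 0).
Qed.

Lemma projective_retract (P Q : lmodType A^c) (i : {linear P -> Q})
    (r : {linear Q -> P}) :
  (forall x, r (i x) = x) -> projective Q -> projective P.
Proof.
move=> ri pQ M N g f gs; have [h hP] := pQ M N g (f \o r : {linear Q -> N}) gs.
by exists (h \o i : {linear P -> M}) => x; rewrite /= hP /= ri.
Qed.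

Lemma projective_prod (P Q : lmodType A^c) : projective P -> projective Q ->
  projective (P * Q)%type.
Proof.
move=> pP pQ M N g f gs.
have [h hP] := pP M N g (f \o in1 P Q : {linear P -> N}) gs.
have [h' h'P] := pQ M N g (f \o in2 P Q : {linear Q -> N}) gs.
exists ((h \o fst) \+ (h' \o snd) : {linear (P * Q)%type -> M}) => -[x y].
rewrite /= linearD hP h'P /= -linearD; congr (f _).
by congr pair; rewrite /= ?addr0 ?add0r.
Qed.

Lemma projective_free n : projective (free_mod n).
Proof.
move=> M N g f gs; have [m mP] := choice (fun i => gs (f (delta_mx 0 i))).
have hL : linear (fun x : 'rV[A^c]_n => \sum_i x 0 i *: m i).
  move=> a u v; rewrite scaler_sumr -big_split; apply: eq_bigr => i _ /=.
  by rewrite !mxE scalerDl scalerA.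
exists (mklin hL) => x /=.
rewrite linear_sum [in RHS](row_sum_delta x) linear_sum.
by apply: eq_bigr => i _; rewrite !linearZ mP.
Qed.

Lemma projective_zero (P : lmodType A^c) : zero_module P -> projective P.
Proof.
move=> P0 M N g f _; exists \0 => x; rewrite linear0 (P0 x) linear0 //.
Qed.

Hypothesis finA : forall M, finite_length M.

(** The kernels of the iterates stabilise at some [n]; an [x] killed by [f] is
[f ^ n y] for some [y], which is killed by [f ^ n.+1], hence by [f ^ n]. *)
Lemma noetherian_surjective_bijective M (f : {linear M -> M}) :
  surjective f -> bijective f.
Proof.
move=> fs; apply: inj_surj_bij => //; apply: linear_inj => x fx.
have [n|n|n nP] := @noetherian_acc _ _
    (fun n => [set x | mklin (iter_linear f n) x = 0]) (finA M).2.
- exact: submodule_ker.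
- by move=> y /= ->; rewrite linear0.
have [y yx] : exists y, iter n f y = x.
  elim: n {nP} => [|n [y yx]]; first by exists x.
  by have [z zy] := fs y; exists z; rewrite iterSr zy.
have : [set x | mklin (iter_linear f n.+1) x = 0] y by rewrite /= yx.
by rewrite nP //= yx.
Qed.

(** Let [q] map a free module [F] onto [M], with kernel [K], and let [U] be a
minimal submodule of [F] with [U + K = F]. Then [q] maps [U] onto [M], and
minimality of [U] makes the kernel of this restriction superfluous. Lifting [q]
through it gives [h : F -> U]; the restriction of [h] to [U] is onto by
minimality of [U], hence bijective, so that [U] is a retract of [F] and thus
projective. *)
Lemma projective_cover_exists M : exists (P : fgmod A) (p : {linear P -> M}),
  projective_cover p.
Proof.
have [n [v vP]] := fgmodP M.
have qL : linear (fun x : free_mod n => \sum_i (x : 'rV_n) 0 i *: v i).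
  move=> a x y; rewrite scaler_sumr -big_split; apply: eq_bigr => i _ /=.
  by rewrite !mxE scalerDl scalerA.
pose q := mklin qL; pose K := [set x | q x = 0].
have sK : submodule K := submodule_ker q.
have qs : surjective q.
  move=> x; have [c ->] := vP x; exists (\row_i c i).
  by apply: eq_bigr => i _; rewrite mxE.
have [||U [sU UK] minU] := @dcc_min _ _
    [set U : set (free_mod n) | submodule U /\ addset U K = setT] (finA _).1.
- by move=> U [].
- exists setT; split; first exact: submoduleT.
  by apply/seteqP; split=> // x _; exists x; rewrite // subrr; case: sK.
have qU x : exists2 u, U u & q u = q x.
  have : addset U K x by rewrite UK.
  by move=> [u Uu /eqP]; rewrite linearB subr_eq0 => /eqP e; exists u.
have addK (V : set (free_mod n)) :
    (forall x, exists2 u, V u & q u = q x) -> addset V K = setT.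
  move=> Vq; apply/seteqP; split=> // x _; have [u Vu e] := Vq x.
  by exists u => //; have : q (x - u) = 0 by rewrite linearB e subrr.
(* N is the submodule U as a module in its own right, with inclusion i *)
have [N [i [iI iU]]] := submodule_type sU.
have iV x : U (i x) by rewrite -iU; exists x.
have onto (V : set (free_mod n)) : submodule V -> V `<=` U ->
    (forall x, exists2 u, V u & q u = q x) -> V = U.
  by move=> sV VU Vq; apply: minU VU; split=> //; apply: addK.
have qis : surjective (q \o i).
  move=> y; have [x <-] := qs y; have [u + e] := qU x.
  by rewrite -iU => -[z _ zu]; exists z; rewrite /= zu.
have [h hP] := @projective_free n _ _ (q \o i : {linear N -> M}) q qis.
have his : surjective (h \o i).
  have e : i @` range (h \o i) = U.
    apply: onto.
    - exact/submodule_image/submodule_image/submoduleT.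
    - by move=> _ [_ [x _ <-] <-].
    move=> x; have [u + <-] := qU x; rewrite -iU => -[z _ <-].
    exists (i ((h \o i) z)); first by exists ((h \o i) z) => //; exists z.
    by have /= -> := hP (i z).
  move=> y; have : U (i y) by [].
  by rewrite -e => -[_ [z _ <-] /iI]; exists z.
have fgN : finitely_generated N.
  apply: (fg_surj (f := h)) (fg_free n) => y.
  by have [x xy] := his y; exists (i x).
have [t hK tK] := @noetherian_surjective_bijective (FgMod fgN)
  (h \o i : {linear N -> N}) his.
have tL := @linear_can _ N N (h \o i : {linear N -> N}) t hK tK.
exists (FgMod fgN), (q \o i : {linear N -> M}); split=> //.
  apply: (@projective_retract _ _ i (mklin tL \o h : {linear _ -> _})) => //.
  exact: projective_free.
move=> V cV VK; have sV : submodule [set` V].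
  by have [V0 VP] := cV; split=> // a x y; apply: VP.
have e : i @` [set` V] = U.
  apply: onto; first exact: submodule_image.
    by move=> _ [x _ <-].
  move=> x; have [u + <-] := qU x; rewrite -iU => -[z _ <-].
  have [w Vw zw] := VK z.
  have e : q (i z) = q (i w).
    by apply/eqP; rewrite -subr_eq0 -!linearB; apply/eqP.
  by exists (i w); [exists w|rewrite e].
move=> x; rewrite inE; have : U (i x) by [].
by rewrite -e => -[y Vy /iI <-].
Qed.

Lemma syzygy_exists M : exists K : fgmod A, is_syzygy M K.
Proof.
have [P [p pc]] := projective_cover_exists M.
have [K [i [iI iK]]] := submodule_type (submodule_ker p).
have fgK : finitely_generated K.
  by apply/span_fg/(finite_length_inj iI (finA P)).2/submoduleT.
by exists (FgMod fgK), P, p, i.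
Qed.

Lemma syzygyP M : is_syzygy M (syzygy M).
Proof.
exact: (ClassicalEpsilon.epsilon_spec (inhabits M) _ (syzygy_exists M)).
Qed.

Inductive decomposable : fgmod A -> Prop :=
| decomposable_zero M of zero_module M : decomposable M
| decomposable_indec M of indecomposable M : decomposable M
| decomposable_sum M N N' of decomposable N & decomposable N' &
    isomorphic M (N * N')%type : decomposable M.

(** Otherwise take a minimal submodule that is not a finite direct sum of
indecomposables.  It splits into two nonzero summands, which are proper
submodules and therefore decomposable. *)
Lemma decomposableT M : decomposable M.
Proof.
apply: contrapT => ndM.
pose C := [set U : set M | exists N (i : {linear N -> M}),
  [/\ injective i, range i = U & ~ decomposable N]].
have [||U [N [i [iI iU ndN]]] minU] := @dcc_min _ _ C (finA M).1.
- by move=> _ [N [i [_ <- _]]]; exact/submodule_image/submoduleT.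
- by exists setT, M, idfun; split=> //; apply/seteqP; split=> // x _; exists x.
have N0 : ~ zero_module N by move=> N0; apply: ndN; apply: decomposable_zero.
suff indN : indecomposable N by apply: ndN; apply: decomposable_indec.
split=> // N1 N2 iN; apply: contrapT => /not_orP[N1n0 N2n0].
have fg1 := fg_summand iN (fgmodP N).
have fg2 := fg_summand (iso_trans iN (iso_prodC _ _)) (fgmodP N).
have [g [g' gK g'K]] := iso_sym iN.
have gI : injective g := can_inj gK.
apply: ndN; apply: (@decomposable_sum _ (FgMod fg1) (FgMod fg2)) => //.
  apply: contrapT => nd1; apply: N2n0 => y.
  have e : range (i \o g \o in1 N1 N2) = U.
    apply: minU.
      exists (FgMod fg1), (i \o (g \o in1 N1 N2) : {linear N1 -> M}).
      by split=> // x z /iI/gI [].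
    by rewrite -iU => _ [x _ <-]; exists (g (x, 0)).
  have : U (i (g (0, y))) by rewrite -iU; exists (g (0, y)).
  by rewrite -e => -[x _ /iI/gI[]].
apply: contrapT => nd2; apply: N1n0 => y.
have e : range (i \o g \o in2 N1 N2) = U.
  apply: minU.
    exists (FgMod fg2), (i \o (g \o in2 N1 N2) : {linear N2 -> M}).
    by split=> // x z /iI/gI [].
  by rewrite -iU => _ [x _ <-]; exists (g (0, x)).
have : U (i (g (y, 0))) by rewrite -iU; exists (g (y, 0)).
by rewrite -e => -[x _ /iI/gI[]].
Qed.

Lemma cancellableT M : cancellable M.
Proof.
elim: (decomposableT M) => {}M.
- exact: cancel_zero.
- exact: cancel_indecomposable.
by move=> N N' _ cN _ cN' i; apply: cancel_iso i (cancel_prod cN cN').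
Qed.

End FiniteLengthModules.

(** * The group K_0 *)

Section GrothendieckGroup.
Variable A : nzRingType.
Implicit Types M N P Q U V : fgmod A.

Lemma iso_class_of_eq M N : isomorphic M N -> iso_class_of M = iso_class_of N.
Proof.
move=> /presentations_iso e; rewrite /iso_class_of.
by apply: eq_exist; exact: e.
Qed.

Definition representative (c : {classic iso_class A}) : fgmod A :=
  projT1 (cid (projT2 (c : iso_class A))).

Lemma representativeK c : iso_class_of (representative c) = c.
Proof.
rewrite /representative; case: c => S SP /=; case: cid => M MP.
by apply: eq_exist; exact: esym MP.
Qed.

Lemma iso_representative M : isomorphic (representative (iso_class_of M)) M.
Proof.
apply/presentations_iso; have := representativeK (iso_class_of M).
by rewrite /iso_class_of => -[].
Qed.

Local Notation free := {freeg {classic iso_class A}}.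
Local Notation pi := (\pi_(K0 A) : {additive free -> K0 A}).

Lemma K0_nullP (D D' : free) : pi D = pi D' <->
  subgroup_gen (@K0_relations A) (D - D').
Proof.
have e := ring_quotient.Quotient.idealrBE (@K0_null A) D D'.
split=> [/eqP|] h; last by apply/eqP; rewrite -e; apply/mem_set.
by apply/set_mem; move: h; rewrite -e.
Qed.

Lemma freeg_ind (H : free -> Prop) : H 0 ->
  (forall D D', H D -> H D' -> H (D - D')) ->
  (forall M, H << iso_class_of M >>) -> forall D, H D.
Proof.
move=> H0 HB H1 D; have HN x : H x -> H (- x) by rewrite -sub0r; apply: HB.
have HD x y : H x -> H y -> H (x + y).
  by move=> Hx /HN Hy; rewrite -[y]opprK; apply: HB.
have HMn x n : H x -> H (x *+ n).
  by move=> Hx; elim: n => // n IH; rewrite mulrS; apply: HD.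
rewrite -(freeg_sumE D); elim/big_rec: _ => // c x _ Hx; apply: HD Hx.
have Hc : H << c >> by rewrite -(representativeK c).
rewrite -[coeff c D]intz -freegU_mulz; case: (coeff c D) => n; first exact: HMn.
exact/HN/HMn.
Qed.

Lemma K0_class_iso M N : isomorphic M N -> K0_class M = K0_class N.
Proof. by move=> /iso_class_of_eq e; rewrite /K0_class e. Qed.

Lemma K0_class_add M M' M'' : isomorphic M (M' * M'')%type ->
  K0_class M = K0_class M' + K0_class M''.
Proof.
move=> i; rewrite -(raddfD pi); apply/K0_nullP; rewrite opprD addrA.
by move=> H _; apply; left; exists M, M', M''.
Qed.

Lemma K0_class_prod M N : K0_class (fg_prod_mod M N) = K0_class M + K0_class N.
Proof. exact/K0_class_add/iso_refl. Qed.

Lemma K0_class_proj P : projective P -> K0_class P = 0.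
Proof.
move=> pP; rewrite -(raddf0 pi); apply/K0_nullP; rewrite subr0.
by move=> H _; apply; right; exists P.
Qed.

Lemma K0_class_generate x : exists U V, x = K0_class U - K0_class V.
Proof.
suff gen D : exists U V, pi D = K0_class U - K0_class V.
  by rewrite -[x]reprK; apply: gen.
elim/freeg_ind: D.
- by exists (zero_mod A), (zero_mod A); rewrite subrr (raddf0 pi).
- move=> D D' [U [V e]] [U' [V' e']].
  exists (fg_prod_mod U V'), (fg_prod_mod V U').
  rewrite (raddfB pi) e e' !K0_class_prod !opprD !opprK !addrA.
  by rewrite addrAC -!addrA; congr (_ + _); rewrite addrCA [- _ + _]addrC.
- move=> M; exists M, (zero_mod A).
  by rewrite (K0_class_proj (projective_zero (@zero_modP A))) subr0.
Qed.

(** The universal property of [K0]; it is used to construct the syzygy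
endomorphism. *)
Lemma K0_lift (Z : zmodType) (f : fgmod A -> Z) :
  (forall M N, isomorphic M N -> f M = f N) ->
  (forall M N, f (fg_prod_mod M N) = f M + f N) ->
  (forall P, projective P -> f P = 0) ->
  exists F : {additive K0 A -> Z}, forall M, F (K0_class M) = f M.
Proof.
move=> fI fD fP; pose g := fglift (f \o representative : _ -> zmodule Z).
have gB : {morph g : x y / x - y} := lift_is_additive _.
have gE M : g << iso_class_of M >> = f M.
  by rewrite /g liftU scale1r; apply/fI/iso_representative.
have g0 : g 0 = 0 by rewrite -(subrr 0) gB subrr.
have g_null D : subgroup_gen (@K0_relations A) D -> g D = 0.
  move=> nD; suff: D \in (fun x => g x == 0) by move/eqP.
  apply: nD; first split.
  - by rewrite unfold_in g0.
  - by move=> x y; rewrite !unfold_in gB => /eqP-> /eqP->; rewrite subrr.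
  move=> _ [[M [M' [M'' [i ->]]]]|[P pP ->]]; rewrite unfold_in.
    by rewrite !gB !gE (fI _ (fg_prod_mod M' M'') i) fD addrAC addrK subrr.
  by rewrite gE fP.
have g_pi D D' : pi D = pi D' -> g D = g D'.
  by move=> /K0_nullP/g_null; rewrite gB => /eqP; rewrite subr_eq0 => /eqP.
pose F (x : K0 A) : Z := g (repr x).
have piK (x : K0 A) : pi (repr x) = x by exact: reprK.
have FB : {morph F : x y / x - y}.
  by move=> x y; rewrite /F -gB; apply: g_pi; rewrite (raddfB pi) !piK.
pose F' := HB.pack_for {additive K0 A -> Z} F
  (GRing.isZmodMorphism.Build _ _ F FB).
by exists F' => M; rewrite -gE; apply: g_pi; rewrite piK.
Qed.

(** This is the form in which equality in [K0] is exploited; it implies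
isomorphism in the stable category. *)
Definition stab_iso U V := exists P Q : fgmod A,
  [/\ projective P, projective Q & isomorphic (U * P)%type (V * Q)%type].

Lemma stab_iso_iso U V : isomorphic U V -> stab_iso U V.
Proof.
move=> i; exists (zero_mod A), (zero_mod A); split.
- exact/projective_zero/zero_modP.
- exact/projective_zero/zero_modP.
- exact/iso_prod/iso_refl.
Qed.

Lemma stab_iso_sym U V : stab_iso U V -> stab_iso V U.
Proof.
by move=> [P [Q [pP pQ i]]]; exists Q, P; split=> //; apply: iso_sym.
Qed.

Lemma stab_iso_trans V U W : stab_iso U V -> stab_iso V W -> stab_iso U W.
Proof.
move=> [P [Q [pP pQ i]]] [P' [Q' [pP' pQ' j]]].
exists (fg_prod_mod P P'), (fg_prod_mod Q' Q); split.
- exact: projective_prod.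
- exact: projective_prod.
apply: iso_trans (iso_prodA _ _ _) _.
apply: iso_trans (iso_prod i (iso_refl _)) _.
apply: iso_trans (iso_prodAC _ _ _) _.
exact: iso_trans (iso_prod j (iso_refl _)) (iso_sym (iso_prodA _ _ _)).
Qed.

Lemma stab_iso_prod U V U' V' : stab_iso U V -> stab_iso U' V' ->
  stab_iso (fg_prod_mod U U') (fg_prod_mod V V').
Proof.
move=> [P [Q [pP pQ i]]] [P' [Q' [pP' pQ' j]]].
exists (fg_prod_mod P P'), (fg_prod_mod Q Q'); split.
- exact: projective_prod.
- exact: projective_prod.
apply: iso_trans (iso_prodACA _ _ _ _) _.
exact: iso_trans (iso_prod i j) (iso_prodACA _ _ _ _).
Qed.

Fixpoint direct_sum (s : seq {classic iso_class A}) : fgmod A :=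
  if s is c :: s' then fg_prod_mod (representative c) (direct_sum s')
  else zero_mod A.

Lemma direct_sum_cat s t : isomorphic (direct_sum (s ++ t))
  (fg_prod_mod (direct_sum s) (direct_sum t)).
Proof.
elim: s => [|c s IH] /=; first exact/iso_sym/iso_prod0/zero_modP.
by apply: iso_trans (iso_prodA _ _ _); apply: iso_prod (iso_refl _) IH.
Qed.

Lemma direct_sum_perm s t : perm_eq s t ->
  isomorphic (direct_sum s) (direct_sum t).
Proof.
elim: s t => [|c s IH] t.
  by rewrite perm_sym => /perm_nilP->; apply: iso_refl.
move=> cst; have ct : c \in t by rewrite -(perm_mem cst) mem_head.
have st : perm_eq s (rem c t).
  by rewrite -(perm_cons c) (permPl cst) perm_to_rem.
apply: iso_trans (iso_prod (iso_refl _) (IH _ st)) _.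
elim: t ct {cst st} => //= d t IHt; rewrite inE eq_sym.
case: eqP => [-> _|_ /= /IHt i]; first exact: iso_refl.
apply: iso_trans (iso_prodCA _ _ _) _.
exact: iso_prod (iso_refl _) i.
Qed.

Local Notation class_sum s := (\sum_(c <- s) << c >> : free).

Lemma class_sum_perm s t : class_sum s = class_sum t -> perm_eq s t.
Proof.
have cE c r : coeff c (class_sum r) = (count_mem c r)%:R.
  elim: r => [|d r IH]; first by rewrite big_nil raddf0.
  by rewrite big_cons raddfD /= IH coeffU mul1r natrD.
move=> e; apply/allP => c _ /=; have := congr1 (coeff c) e.
by rewrite !cE => /eqP; rewrite eqr_nat.
Qed.

Hypothesis finA : forall M, finite_length M.

(** The elements of the free group of the form [s - t], where the direct sums
of the families of classes [s] and [t] are isomorphic up to projectives, form a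
subgroup containing the defining relations of [K0]. So [U - V = s - t] for such
[s] and [t]; comparing multiplicities, [U + t] and [V + s] have isomorphic
direct sums, and the direct sum of [t] can be cancelled since it agrees with
that of [s] up to projectives. *)
Lemma K0_class_eq U V : K0_class U = K0_class V -> stab_iso U V.
Proof.
move=> /K0_nullP nUV.
pose H : set free := [set D | exists s t,
  D = class_sum s - class_sum t /\ stab_iso (direct_sum s) (direct_sum t)].
have : << iso_class_of U >> - << iso_class_of V >> \in in_set H.
  apply: nUV; first split.
  - apply/mem_set; exists [::], [::].
    by rewrite subrr; split=> //; apply: stab_iso_iso (iso_refl _).
  - move=> D D' /set_mem[s [t [-> st]]] /set_mem[s' [t' [-> st']]].
    apply/mem_set; exists (s ++ t'), (t ++ s'); split.
      by rewrite !big_cat /= opprB opprD addrACA.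
    apply: stab_iso_trans (stab_iso_iso (direct_sum_cat _ _)) _.
    apply: stab_iso_trans _ (stab_iso_sym (stab_iso_iso (direct_sum_cat _ _))).
    exact: stab_iso_prod st (stab_iso_sym st').
  move=> _ [[M [M' [M'' [i ->]]]]|[P pP ->]]; apply/mem_set.
    exists [:: iso_class_of M], [:: iso_class_of M'; iso_class_of M''].
    rewrite !big_cons !big_nil !addr0 opprD addrA; split=> //=.
    apply: stab_iso_iso; apply: iso_trans (iso_prodC _ _) _.
    apply: iso_trans (iso_prod0 _ (@zero_modP A)) _.
    apply: iso_trans (iso_representative _) (iso_trans i _).
    apply: iso_prod; first exact/iso_sym/iso_representative.
    apply: iso_trans (iso_prodC _ _).
    apply: iso_trans (iso_sym (iso_prod0 _ (@zero_modP A))).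
    exact/iso_sym/iso_representative.
  exists [:: iso_class_of P], [::]; rewrite big_cons !big_nil addr0 subr0.
  split=> //=; exists (zero_mod A), P; split=> //.
    exact/projective_zero/zero_modP.
  apply: iso_trans (iso_prodC _ _) (iso_prod (iso_refl _) _).
  apply: iso_trans (iso_prodC _ _) _.
  exact: iso_trans (iso_prod0 _ (@zero_modP A)) (iso_representative _).
move=> /set_mem[s [t [/eqP e st]]].
have /class_sum_perm/direct_sum_perm i : 
    class_sum (iso_class_of U :: t) = class_sum (iso_class_of V :: s).
  apply/eqP; rewrite !big_cons; move: e; rewrite subr_eq addrAC.
  by rewrite eq_sym subr_eq eq_sym [<< iso_class_of V >> + _]addrC.
have {i}i : isomorphic (U * direct_sum t)%type (V * direct_sum s)%type.
  apply: iso_trans (iso_prod (iso_sym (iso_representative _)) (iso_refl _)) _.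
  exact: iso_trans i (iso_prod (iso_representative _) (iso_refl _)).
have [P [Q [pP pQ j]]] := st.
exists P, Q; split=> //; apply: (cancellableT finA (M := direct_sum t)).
apply: iso_trans (iso_prodA _ _ _) _.
apply: iso_trans (iso_prod (iso_trans (iso_prodC _ _) i) (iso_refl _)) _.
apply: iso_trans (iso_sym (iso_prodA _ _ _)) _.
exact: iso_trans (iso_prod (iso_refl _) j) (iso_prodCA _ _ _).
Qed.

End GrothendieckGroup.

(** * Iterates of an endomorphism of an abelian group *)

Lemma noetherian_int : noetherian int^o.
Proof.
move=> U sU; have [U0|nU0] := pselect (U `<=` [set 0]).
  by apply: (@fgset_sub _ _ _ [::]).
have UN (x : int) : U x -> U (- x) := @submoduleN _ _ U x sU.
have exP : exists n : nat, `[< U (n.+1 : int) >].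
  apply: contrapT => nex; apply: nU0 => x Ux; apply: contrapT => xN0.
  apply: nex; case: x xN0 Ux => [[|n]|n] xN0 Ux; first by case: xN0.
    by exists n; apply/asboolP.
  by exists n; apply/asboolP; have := UN _ Ux; rewrite NegzE opprK.
case: (ex_minnP exP) => n /asboolP Un minn.
apply: (@fgset_sub _ int^o U [:: (n.+1%:Z : int^o)]) => //.
  by move=> x; rewrite inE => /eqP->.
move=> x Ux; exists (divz x n.+1) => /=.
have xE := divz_eq x n.+1.
have -> : x - (divz x n.+1) *: (n.+1%:Z : int^o) = modz x n.+1.
  by rewrite {1}xE addrC addKr.
have Ur : U (modz x n.+1).
  have -> : modz x n.+1 = x - (divz x n.+1) *: (n.+1%:Z : int^o).
    by rewrite {2}xE addrC addKr.
  by apply: submoduleB => //; apply: submoduleZ.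
have r0 : 0 <= modz x n.+1 by apply: modz_ge0.
have rn : modz x n.+1 < n.+1 by apply: ltz_pmod.
move: Ur r0 rn; case: (modz x n.+1) => // -[//|m] Um _.
rewrite ltz_nat ltnS => mn; have := minn m; rewrite leqNgt mn => h.
by have := h (asboolT Um).
Qed.

Lemma noetherian_fg (R : nzRingType) (M : lmodType R) : noetherian R^o ->
  finitely_generated M -> noetherian M.
Proof.
move=> nR /span_fg[s sE] U sU.
by apply: (noetherian_lspan (s := s)); rewrite -?sE.
Qed.

(** In this section [L ^ n] has finitely generated range, while the ambient
group is arbitrary; abelian groups are modules over [int] here. *)
Section Iterates.
Variables (V : lmodType int) (L : {linear V -> V}) (n : nat).
Hypothesis fgL : fgset (range (iter n L)).

Lemma iter_linear0 m : iter m L 0 = 0.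
Proof. exact: linear0 (mklin (iter_linear L m)). Qed.

(** The range of [L ^ n] as a module of its own, so that the ascending chain
condition applies to it. *)
Lemma iter_image_type : exists (N : lmodType int) (i : {linear N -> V}),
  range i = range (iter n L) /\ noetherian N.
Proof.
have sG : submodule (range (mklin (iter_linear L n))).
  exact/submodule_image/submoduleT.
have [N [i [iI iG]]] := submodule_type sG; exists N, i; split=> //.
apply: noetherian_fg noetherian_int _; apply/span_fg.
apply: (@fgset_extension _ _ _ i); first exact: submoduleT.
  by rewrite iG.
apply: (@fgset_sub _ _ _ [::]) => //; first exact/submoduleI/submodule_ker.
by move=> x [_ /= ix]; apply: iI; rewrite ix linear0.
Qed.

(** The kernels of the powers of [L] on the range of [L ^ n] stabilise. *)
Lemma iter_inj_eventually : exists d, forall m x, (d <= m)%N ->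
  L (iter m L x) = 0 -> iter m L x = 0.
Proof.
have [N [i [iG nN]]] := iter_image_type.
pose T j := [set y | (mklin (iter_linear L j) \o i) y = 0].
have [j|j|j jP] := @noetherian_acc _ _ T nN.
- exact: submodule_ker.
- by move=> y Ty; rewrite /T /= [iter j L (i y)]Ty linear0.
exists (n + j)%N => m x; rewrite addnC => njm.
have jm : (j <= m - n)%N.
  by rewrite leq_subRL // (leq_trans _ njm) ?leq_addl // addnC.
have nm : (n <= m)%N by rewrite (leq_trans _ njm) ?leq_addl.
rewrite -(subnK nm) iterD -iterS.
have : range i (iter n L x) by rewrite iG; exists x.
move=> [y _ <-] Ty; have : T (m - n).+1 y by [].
by rewrite jP 1?leqW // -(jP (m - n)%N).
Qed.

(** The action on [x] of the polynomial in [L] with coefficient list [cs],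
constant term first. *)
Fixpoint poly_action (cs : seq int) (x : V) : V :=
  if cs is c :: cs' then c *: x + L (poly_action cs' x) else 0.

Lemma poly_action_comm cs m x :
  poly_action cs (iter m L x) = iter m L (poly_action cs x).
Proof.
elim: cs => /= [|c cs ->]; first by rewrite iter_linear0.
by rewrite iter_linear /= -iterSr.
Qed.

Lemma poly_action_oppr cs x : poly_action (map -%R cs) x = - poly_action cs x.
Proof.
elim: cs => /= [|c cs ->]; first by rewrite oppr0.
by rewrite linearN opprD scaleNr.
Qed.

Lemma poly_action_rcons cs c x :
  poly_action (rcons cs c) x = poly_action cs x + c *: iter (size cs) L x.
Proof.
elim: cs => /= [|c' cs ->]; first by rewrite linear0 addrC.
by rewrite linearD linearZ addrA.
Qed.

Lemma lspan_traject s x y : lspan (traject L x s) y ->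
  exists2 cs, size cs = s & y = poly_action cs x.
Proof.
elim: s x y => [|s IH] x y /=; first by move=> ->; exists [::].
move=> [c /IH[cs css e]]; exists (c :: cs); rewrite /= ?css //.
by rewrite -[L _]/(iter 1 L _) -poly_action_comm -e addrC subrK.
Qed.

(** The spans of the initial segments of the sequence [L ^ n x], [L ^ n.+1 x],
and so on form an ascending chain in the finitely generated range of [L ^ n];
where it stops growing, the next term depends on the previous ones. *)
Lemma iter_monic_relation x : exists cs,
  poly_action (rcons cs 1) (iter n L x) = 0.
Proof.
have [N [i [iG nN]]] := iter_image_type.
pose T s := i @^-1` (lspan (traject L (iter n L x) s)).
have [s|s|s sP] := @noetherian_acc _ _ T nN.
- exact/submodule_preimage/submodule_lspan.
- move=> y; apply: lspan_mono => z.
  by rewrite trajectSr mem_rcons inE orbC => ->.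
have : range i (iter s L (iter n L x)).
  by rewrite iG; exists (iter s L x); rewrite // -!iterD addnC.
move=> [y _ iy]; have : T s.+1 y.
  suff : lspan (traject L (iter n L x) s.+1) (i y) by [].
  by apply: mem_lspan; rewrite iy trajectSr mem_rcons mem_head.
rewrite sP // /T /= iy => /lspan_traject[cs css e].
exists (map -%R cs).
by rewrite poly_action_rcons poly_action_oppr size_map css -e scale1r addNr.
Qed.

(** A monic polynomial in [L] that kills a further iterate of [L ^ d x] kills
[L ^ d x] itself, by injectivity. If its constant coefficient is zero, a factor
[L] can be cancelled by injectivity; being monic, the polynomial has a first
nonzero coefficient [t], and the relation then expresses [t] times [L ^ d x] as
a value of [L]. *)
Lemma iter_multiple d x : 
  (forall y, L (iter d L y) = 0 -> iter d L y = 0) ->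
  exists (t : int) z, t != 0 /\ t *: iter d L x = iter d.+1 L z.
Proof.
move=> dI; have [cs] := iter_monic_relation (iter d L x).
rewrite poly_action_comm poly_action_comm.
have nI m y : iter m L (iter d L y) = 0 -> iter d L y = 0.
  elim: m => // m IH; rewrite iterS -iterD addnC iterD => /dI.
  by rewrite -iterD addnC iterD => /IH.
move=> /nI; elim: cs => [|c cs IH] /=.
  rewrite linear0 addr0 scale1r => e; exists 1, 0.
  by rewrite scale1r e iter_linear0 linear0.
have [->|cN0] := eqVneq c 0.
  by rewrite scale0r add0r -iterSr => /dI.
move=> e; exists c, (- poly_action (rcons cs 1) x); split=> //.
move: e; rewrite iter_linear /= -iterSr => /eqP.
rewrite addr_eq0 => /eqP->.
exact: esym (linearN (mklin (iter_linear L d.+1)) _).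
Qed.

End Iterates.

(** * Infima and suprema of extended natural numbers *)

Section ExtendedNaturals.
Implicit Types (S : set nat) (T : set (\bar int)) (d n : nat).

Definition ext_nat (v : \bar int) := v = +oo%E \/ exists n, v = n%:Z%:E.

Lemma ext_nat_ge0 v : ext_nat v -> (0 <= v)%E.
Proof. by move=> [->|[n ->]]; rewrite ?leey // lee_fin. Qed.

Lemma nat_inf_cases S : (S = set0 /\ nat_inf S = +oo%E) \/
  exists n, [/\ S n, nat_inf S = n%:Z%:E & forall m, S m -> (n <= m)%N].
Proof.
have [->|/set0P[m0 Sm0]] := eqVneq S set0.
  by left; rewrite /nat_inf image_set0 /infimum eqxx.
right; have exS : exists n, `[< S n >] by exists m0; apply/asboolP.
case: (ex_minnP exS) => n /asboolP Sn minn; exists n; split=> //; last first.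
  by move=> m /asboolP/minn.
rewrite /nat_inf /infimum ifF; last first.
  by apply/negP => /eqP e; have : set0 (n%:Z%:E) by rewrite -e; exists n.
apply: xget_unique.
  split; last by move=> y; apply; exists n.
  by move=> _ [m Sm <-]; rewrite lee_fin lez_nat; apply/minn/asboolP.
move=> y [lby uby]; apply/eqP; rewrite eq_le; apply/andP; split.
  by apply: lby; exists n.
by apply: uby => _ [m Sm <-]; rewrite lee_fin lez_nat; apply/minn/asboolP.
Qed.

Lemma ext_nat_inf S : ext_nat (nat_inf S).
Proof.
by have [[_ ->]|[n [_ -> _]]] := nat_inf_cases S; [left|right; exists n].
Qed.

Lemma nat_inf_le S d : (nat_inf S <= d%:Z%:E)%E <-> exists2 n, S n & (n <= d)%N.
Proof.
have [[-> ->]|[n [Sn -> minn]]] := nat_inf_cases S.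
  by split=> // -[].
rewrite lee_fin lez_nat; split=> [nd|[m /minn nm md]]; first by exists n.
exact: leq_trans md.
Qed.

Lemma inv_sup_supremum T :
  T `<=` ext_nat -> T !=set0 -> supremums T (inv_sup T).
Proof.
move=> Text T0; rewrite /inv_sup /supremum ifF; last by apply/negP => /eqP e;
  move: T0; rewrite e => -[].
apply: xgetPex; have [T1 Tt1] := T0.
have [[d0 bd0]|nb] := pselect (exists d, ubound T d%:Z%:E); last first.
  exists +oo%E; split=> [x _|y uy]; first exact: leey.
  have : (0 <= y)%E by apply: le_trans (uy _ Tt1); apply/ext_nat_ge0/Text.
  case: y uy => [[e|e]|//|//] uy; rewrite ?lee_fin // => _.
  by case: nb; exists e.
have exb : exists d, `[< ubound T d%:Z%:E >] by exists d0; apply/asboolP.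
case: (ex_minnP exb) => d /asboolP ubd mind; exists d%:Z%:E; split=> // y uy.
have : (0 <= y)%E by apply: le_trans (uy _ Tt1); apply/ext_nat_ge0/Text.
case: y uy => [[e|e]|//|//] uy; rewrite ?leey ?lee_fin // => _.
by rewrite lez_nat; apply/mind/asboolP.
Qed.

Lemma le_inv_sup T v : T `<=` ext_nat -> T v -> (v <= inv_sup T)%E.
Proof.
by move=> Text Tv; have [|+ _] := inv_sup_supremum Text; [exists v|apply].
Qed.

Lemma inv_sup_le T b : T `<=` ext_nat -> (0 <= b)%E ->
  (forall v, T v -> (v <= b)%E) -> (inv_sup T <= b)%E.
Proof.
move=> Text b0 Tb; have [->|/set0P T0] := eqVneq T set0.
  by rewrite /inv_sup supremum0.
by have [_] := inv_sup_supremum Text T0; apply.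
Qed.

End ExtendedNaturals.

(** * The syzygy endomorphism of K_0 *)

Section Syzygies.
Variable A : nzRingType.
Implicit Types M N K L P Q U V : fgmod A.

Definition projective_presentation (M K P : lmodType A^c) := projective P /\
  exists (p : {linear P -> M}) (i : {linear K -> P}),
    [/\ surjective p, injective i & range i = [set x | p x = 0]].

(** Let [h : P -> P'] and [h' : P' -> P] lift the two surjections through each
other.  The kernel of [P * P' -> M], [(x, y) |-> p x + p' y], equals [K * P'] in
the coordinates [(x + h' y, y)] and [P * K'] in the coordinates [(x, y + h x)];
comparing the coordinates gives the two inverse maps below. *)
Lemma schanuel (M K P K' P' : lmodType A^c) : projective_presentation M K P ->
  projective_presentation M K' P' -> isomorphic (K * P')%type (K' * P)%type.
Proof.
move=> [pP [p [i [ps iI iK]]]] [pP' [p' [i' [ps' iI' iK']]]].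
have [h hP] := pP _ _ p' p ps'; have [h' h'P] := pP' _ _ p p' ps.
have pi k : p (i k) = 0 by have : range i (i k) by [exists k]; rewrite iK.
have pi' k : p' (i' k) = 0 by have : range i' (i' k) by [exists k]; rewrite iK'.
have lift x : p x = 0 -> exists k, i k = x.
  by move=> px; have : range i x by [rewrite iK]; move=> [k _ <-]; exists k.
have lift' x : p' x = 0 -> exists k, i' k = x.
  by move=> px; have : range i' x by [rewrite iK']; move=> [k _ <-]; exists k.
have ex z : exists w : K' * P,
    i' w.1 = z.2 + h (i z.1 - h' z.2) /\ w.2 = i z.1 - h' z.2.
  have [|k' k'E] := lift' (z.2 + h (i z.1 - h' z.2)).
    by rewrite linearD hP linearB pi h'P sub0r subrr.
  by exists (k', i z.1 - h' z.2).
have ex' w : exists z : K * P',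
    i z.1 = w.2 + h' (i' w.1 - h w.2) /\ z.2 = i' w.1 - h w.2.
  have [|k kE] := lift (w.2 + h' (i' w.1 - h w.2)).
    by rewrite linearD h'P linearB pi' hP sub0r subrr.
  by exists (k, i' w.1 - h w.2).
have [f fP] := choice ex; have [g gP] := choice ex'.
apply: (@iso_mk _ _ _ f g).
- move=> a u v; have [f1 f2] := fP (a *: u + v).
  have [u1 u2] := fP u; have [v1 v2] := fP v.
  rewrite [LHS]surjective_pairing; congr pair; last first.
    by rewrite f2 /= u2 v2 (linearP i) (linearP h') scalerBr opprD addrACA.
  apply: iI'; rewrite f1 [RHS](linearP i') u1 v1 scalerDr addrACA -(linearP h).
  congr (_ + h _); rewrite scalerBr addrACA -opprD.
  by rewrite -(linearP i) -(linearP h').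
- move=> z; have [g1 g2] := gP (f z); have [f1 f2] := fP z.
  rewrite [LHS]surjective_pairing [RHS]surjective_pairing.
  have e2 : (g (f z)).2 = z.2 by rewrite g2 f1 f2 addrK.
  by congr pair => //; apply: iI; rewrite g1 -g2 e2 f2 subrK.
- move=> w; have [g1 g2] := gP w; have [f1 f2] := fP (g w).
  rewrite [LHS]surjective_pairing [RHS]surjective_pairing.
  have e2 : (f (g w)).2 = w.2 by rewrite f2 g1 g2 addrK.
  by congr pair => //; apply: iI'; rewrite f1 -f2 e2 g2 subrK.
Qed.

Lemma presentation_iso (M N K P : lmodType A^c) : isomorphic M N ->
  projective_presentation M K P -> projective_presentation N K P.
Proof.
move=> [f [g fK gK]] [pP [p [i [ps iI iK]]]]; split=> //.
exists (f \o p : {linear P -> N}), i; split=> //.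
  by move=> y; have [x xy] := ps (g y); exists x; rewrite /= xy.
rewrite iK; apply/seteqP; split=> x /= e; first by rewrite e linear0.
by apply: (can_inj fK); rewrite e linear0.
Qed.

Lemma presentation_prod (M K P N L Q : lmodType A^c) :
  projective_presentation M K P -> projective_presentation N L Q ->
  projective_presentation (M * N)%type (K * L)%type (P * Q)%type.
Proof.
move=> [pP [p [i [ps iI iK]]]] [pQ [q [j [qs jI jL]]]].
split; first exact: projective_prod.
have pqL : linear (fun z : P * Q => (p z.1, q z.2)).
  by move=> a u v; congr pair; rewrite /= linearP.
have ijL : linear (fun z : K * L => (i z.1, j z.2)).
  by move=> a u v; congr pair; rewrite /= linearP.
exists (mklin pqL), (mklin ijL); split.
- move=> [x y]; have [u ux] := ps x; have [v vy] := qs y.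
  by exists (u, v); rewrite /= ux vy.
- by move=> [x y] [x' y'] /= [/iI-> /jI->].
apply/seteqP; split=> [_ [[x y] _ <-]|[x y] /= [px qy]] /=.
  have : range i (i x) by [exists x]; have : range j (j y) by [exists y].
  by rewrite iK jL /= => -> ->.
have [x' _ <-] : range i x by rewrite iK.
have [y' _ <-] : range j y by rewrite jL.
by exists (x', y').
Qed.

Lemma presentation_proj (P Z : lmodType A^c) : projective P -> zero_module Z ->
  projective_presentation P Z P.
Proof.
move=> pP Z0; split=> //; exists idfun, \0; split.
- by move=> x; exists x.
- by move=> x y _; rewrite (Z0 x) (Z0 y).
by apply/seteqP; split=> [_ [x _ <-]|x /= ->] //; exists 0.
Qed.

Hypothesis finA : forall M, finite_length M.

Lemma presentation_syzygy M : exists P, projective_presentation M (syzygy M) P.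
Proof.
have [P [p [i [[pP ps _] iI iK]]]] := syzygyP finA M.
by exists P; split=> //; exists p, i.
Qed.

Lemma K0_class_presentation M K K' P P' : projective_presentation M K P ->
  projective_presentation M K' P' -> K0_class K = K0_class K'.
Proof.
move=> r r'; have i := schanuel r r'.
have := @K0_class_iso _ (fg_prod_mod K P') (fg_prod_mod K' P) i.
by rewrite !K0_class_prod (K0_class_proj r.1) (K0_class_proj r'.1) !addr0.
Qed.

(** By Schanuel's lemma the class of the kernel of a projective presentation
depends only on the module presented, so additivity can be read off from the
direct sum of two presentations and the vanishing on projectives from the
identity map. *)
Lemma K0_syzygyE M : K0_syzygy A (K0_class M) = K0_class (syzygy M).
Proof.
suff h : exists f : {additive K0 A -> K0 A},
    forall N, f (K0_class N) = K0_class (syzygy N).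
  exact: (ClassicalEpsilon.epsilon_spec
    (inhabits (idfun : {additive K0 A -> K0 A})) _ h M).
apply: (@K0_lift _ _ (fun N => K0_class (syzygy N))) => {M}.
- move=> M N i; have [P r] := presentation_syzygy M.
  have [Q r'] := presentation_syzygy N.
  exact: K0_class_presentation (presentation_iso i r) r'.
- move=> M N; have [P r] := presentation_syzygy M.
  have [Q r'] := presentation_syzygy N.
  have [T rT] := presentation_syzygy (fg_prod_mod M N).
  rewrite -K0_class_prod.
  exact: (@K0_class_presentation _ _ (fg_prod_mod _ _) _ (fg_prod_mod P Q) rT
    (presentation_prod r r')).
- move=> P pP; have [Q r] := presentation_syzygy P.
  rewrite (K0_class_presentation r (presentation_proj pP (@zero_modP A))).
  exact/K0_class_proj/projective_zero/zero_modP.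
Qed.

Lemma iter_K0_syzygyE n M :
  iter n (K0_syzygy A) (K0_class M) = K0_class (iter n (@syzygy A) M).
Proof. by elim: n => //= n ->; rewrite K0_syzygyE. Qed.

Lemma stably_isomorphic_stab U V : stab_iso U V -> stably_isomorphic U V.
Proof.
move=> [P [Q [pP pQ [h [h' hK h'K]]]]]; pose H' := mklin (linear_can hK h'K).
exists (fst \o (h \o in1 U P) : {linear U -> V}).
exists (fst \o (H' \o in1 V Q) : {linear V -> U}); split.
  exists Q, (snd \o (h \o in1 U P) : {linear U -> Q}).
  exists (- (fst \o (H' \o in2 V Q)) : {linear Q -> U}); split=> // u.
  have e : H' (in1 V Q (h (u, 0)).1) + H' (in2 V Q (h (u, 0)).2) = (u, 0).
    rewrite -linearD -[RHS]hK; congr (h' _); rewrite [RHS]surjective_pairing.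
    by congr pair; rewrite /= ?addr0 ?add0r.
  have /= ev := congr1 fst e.
  by rewrite /= -[X in _ - X]ev opprD addrA subrr add0r.
exists P, (snd \o (H' \o in1 V Q) : {linear V -> P}).
exists (- (fst \o (h \o in2 U P)) : {linear P -> V}); split=> // v.
have e : h (in1 U P (H' (v, 0)).1) + h (in2 U P (H' (v, 0)).2) = (v, 0).
  rewrite -linearD -[RHS]h'K; congr (h _); rewrite [RHS]surjective_pairing.
  by congr pair; rewrite /= ?addr0 ?add0r.
have /= ev := congr1 fst e.
by rewrite /= -[X in _ - X]ev opprD addrA subrr add0r.
Qed.

(** A direct summand is a direct sum of indecomposables, each of which is a
direct summand of [M] as well. *)
Lemma add_subgroup_summand M N : direct_summand N M ->
  add_subgroup M (K0_class N).
Proof.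
elim: (decomposableT finA N) => {}N.
- move=> N0 _; rewrite (K0_class_proj (projective_zero N0)).
  by move=> H [].
- by move=> indN NM H _; apply; exists N.
move=> N1 N2 _ IH1 _ IH2 i [N' j]; rewrite (K0_class_add i) => H cH gH.
have {}j := iso_trans j (iso_prod i (iso_refl N')).
have [H0 HB] := cH; rewrite -[K0_class N2]opprK -[- K0_class N2]sub0r.
apply: (HB); last apply: HB H0 _.
  apply: IH1 cH gH; exists (N2 * N')%type.
  exact: iso_trans j (iso_sym (iso_prodA _ _ _)).
apply: IH2 cH gH; exists (N1 * N')%type.
apply: iso_trans j (iso_trans _ (iso_sym (iso_prodA _ _ _))).
exact: iso_prod (iso_prodC _ _) (iso_refl _).
Qed.

End Syzygies.

(** * Syzygy finite rings *)

Section SyzygyFinite.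
Variable A : nzRingType.
Hypothesis finA : forall M : fgmod A, finite_length M.
Implicit Types M N X Y : fgmod A.

Local Notation K0Z := (zmodule (K0 A)).

Lemma K0_syzygy_linear : linear (K0_syzygy A : K0Z -> K0Z).
Proof. by move=> a x y; rewrite raddfD /= raddfMz. Qed.

Local Notation L := (mklin K0_syzygy_linear).

Lemma fg_subgroup_fgset (V : zmodType) (G : set V) : fg_subgroup G ->
  fgset (G : set (zmodule V)).
Proof.
move=> [s ->]; exists s; apply/seteqP; split=> x /=.
  move=> sx; apply/set_mem/sx; first split.
  - by apply: mem_set; case: (submodule_lspan (s : seq (zmodule V))).
  - move=> u v /set_mem su /set_mem sv; apply/mem_set.
    exact: (submoduleB (submodule_lspan (s : seq (zmodule V))) su sv).
  by move=> y ys; apply/mem_set/(@mem_lspan _ (zmodule V)).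
move=> sx H [H0 HB] sH.
have HN u : u \in H -> - u \in H by rewrite -sub0r; apply: HB.
have HD u v : u \in H -> v \in H -> u + v \in H.
  by move=> Hu /HN Hv; rewrite -[v]opprK; apply: HB.
have HMn u m : u \in H -> u *+ m \in H.
  by move=> Hu; elim: m => // m IH; rewrite mulrS; apply: HD.
suff sub : lspan (s : seq (zmodule V)) `<=` [set u | u \in H] by exact: sub sx.
apply: lspan_sub; last by move=> u /sH.
split=> // c u v /= Hu Hv; apply: HD => //.
by case: c => m; [apply: HMn|apply/HN/HMn].
Qed.

(** The syzygy endomorphism is injective on [K_d]. *)
Definition syzygy_injective d := forall x : K0 A,
  K0_syzygy A (iter d (K0_syzygy A) x) = 0 -> iter d (K0_syzygy A) x = 0.

Lemma iter_K0_syzygyB m (x y : K0 A) : iter m (K0_syzygy A) (x - y) =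
  iter m (K0_syzygy A) x - iter m (K0_syzygy A) y.
Proof. exact: (linearB (mklin (iter_linear L m))). Qed.

Lemma phi_le d M : (forall m, (d <= m)%N -> syzygy_injective m) ->
  (phi M <= d%:Z%:E)%E.
Proof.
move=> dI; apply/nat_inf_le; exists d => // m dm; split.
- by move=> _ [x Gx <-]; exists x.
- move=> _ _ /set_mem[x Gx <-] /set_mem[y Gy <-] e.
  apply/eqP; rewrite -subr_eq0 -iter_K0_syzygyB; apply/eqP/(dI m dm).
  by rewrite iter_K0_syzygyB raddfB e subrr.
- by move=> _ [x Gx <-]; exists (iter m (K0_syzygy A) x) => //; exists x.
Qed.

(** An element [U - V] of [K0] belongs to the subgroup attached to [U * V],
whose [phi] is at most [d]. *)
Lemma phi_le_injective d : (forall M, (phi M <= d%:Z%:E)%E) ->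
  syzygy_injective d.
Proof.
move=> phid x Lx; have [U [V xE]] := K0_class_generate x.
pose G := add_subgroup (fg_prod_mod U V).
have cG := subgroup_gen_closed [set c | exists N : fgmod A,
  [/\ indecomposable N, direct_summand N (fg_prod_mod U V) & c = K0_class N]].
have GU : G (K0_class U).
  by apply: add_subgroup_summand => //; exists V; apply: iso_refl.
have GV : G (K0_class V).
  by apply: add_subgroup_summand => //; exists U; apply: iso_prodC.
have G0 : G 0 by apply/set_mem; exact: cG.1.
have Gx : G x by rewrite xE; apply/set_mem/cG.2; exact/mem_set.
have /nat_inf_le[n nP nd] := phid (fg_prod_mod U V).
have [_ inj _] := nP d nd.
have i0 : iter d (K0_syzygy A) 0 = 0 by exact: (iter_linear0 L).
apply: inj; last by rewrite Lx raddf0.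
  by apply: mem_set; exists x.
by apply: mem_set; exists 0.
Qed.

Lemma K0_multiple_iter N n : exists M, K0_class M = K0_class N *+ n.
Proof.
elim: n => [|n [M e]].
  exists (zero_mod A).
  by rewrite (K0_class_proj (projective_zero (@zero_modP A))).
by exists (fg_prod_mod N M); rewrite K0_class_prod e mulrS.
Qed.

(** A positive multiple of the class of the [d]-th syzygy of [M] is a
difference of classes of [d.+1]-st syzygies of modules [X] and [Y]; moving the
negative term to the other side turns this into a stable direct sum
decomposition for [X]. *)
Lemma dell_le d n M : fgset (range (iter n L)) -> syzygy_injective d ->
  (dell M <= d%:Z%:E)%E.
Proof.
move=> fgL dI; apply/nat_inf_le; exists d => //.
have [t [z [tN0 tz]]] := @iter_multiple _ L n fgL d (K0_class M) dI.
have {t z tN0 tz}[t [z tz]] : exists t z,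
    iter d (K0_syzygy A) (K0_class M) *+ t.+1 = iter d.+1 (K0_syzygy A) z.
  case: t tN0 tz => [[|t]|t] // _ tz; first by exists t, z.
  (* a negative multiple: replace z by its opposite *)
  exists t, (0 - z); rewrite iter_K0_syzygyB -[iter _ _ z]tz.
  have -> : iter d.+1 (K0_syzygy A) 0 = 0.
    exact: (iter_linear0 L).
  by rewrite sub0r NegzE [X in _ = - X]scaleNr opprK.
have [X [Y zE]] := K0_class_generate z.
move: tz; rewrite zE iter_K0_syzygyB !iter_K0_syzygyE // => tz.
have e : K0_class (iter d.+1 (@syzygy A) X) =
    K0_class (iter d (@syzygy A) M) *+ t.+1 +
    K0_class (iter d.+1 (@syzygy A) Y).
  by rewrite tz subrK.
have [T TE] := K0_multiple_iter (iter d (@syzygy A) M) t.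
exists X; exists (fg_prod_mod T (iter d.+1 (@syzygy A) Y)).
pose Z := fg_prod_mod (iter d (@syzygy A) M)
  (fg_prod_mod T (iter d.+1 (@syzygy A) Y)).
apply: (@stably_isomorphic_stab _ _ Z); apply: K0_class_eq => //.
by rewrite e !K0_class_prod TE mulrS addrA.
Qed.

Lemma syzygy_finite_bounds : syzygy_finite A ->
  (dell_alg A <= Dell A)%E /\ (Dell A <= phidim A)%E /\ (phidim A < +oo)%E.
Proof.
move=> [n fgn].
have fgL : fgset (range (iter n L)) by exact: fg_subgroup_fgset fgn.
have [d0 d0P] := iter_inj_eventually fgL.
have extS :
    [set d | exists2 S : fgmod A, simple_module S & d = dell S] `<=` ext_nat.
  by move=> _ [S _ ->]; apply: ext_nat_inf.
have extD : [set d | exists M, d = @dell A M] `<=` ext_nat.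
  by move=> _ [M ->]; apply: ext_nat_inf.
have extP : [set d | exists M, d = @phi A M] `<=` ext_nat.
  by move=> _ [M ->]; apply: ext_nat_inf.
have phid0 : (phidim A <= d0%:Z%:E)%E.
  apply: inv_sup_le => //.
  by move=> _ [M ->]; apply: phi_le => m dm x; apply: d0P.
have phi0 : (0 <= phidim A)%E.
  apply: le_trans (le_inv_sup extP _); last by exists (zero_mod A).
  exact/ext_nat_ge0/ext_nat_inf.
have [d dE] : exists d : nat, phidim A = d%:Z%:E.
  by move: phid0 phi0; case: (phidim A) => [[d|d]|//|//]; exists d.
split; last split.
- apply: inv_sup_le => //.
    apply: le_trans (le_inv_sup extD _); last by exists (zero_mod A).
    exact/ext_nat_ge0/ext_nat_inf.
  by move=> _ [S _ ->]; apply: le_inv_sup => //; exists S.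
- apply: inv_sup_le => // _ [M ->]; rewrite dE.
  apply: dell_le fgL _; apply: phi_le_injective => N.
  by rewrite -dE; apply: le_inv_sup => //; exists N.
- by rewrite dE ltry.
Qed.

End SyzygyFinite.

Theorem proposition3p9 (k : comNzRingType) (A : algType k) :
  artin_algebra A -> syzygy_finite A ->
  (dell_alg A <= Dell A)%E /\ (Dell A <= phidim A)%E /\ (phidim A < +oo)%E.
Proof.
move=> artA; apply: syzygy_finite_bounds => M.
exact: artin_finite_length artA (fgmodP M).
Qed.
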